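(* There exists $h_0$ such that for every $h > h_0$, every strongly asymmetric graph $H \in \mathcal{P}_h$ on $h$ vertices, and every positive integer $n \le 2^{\sqrt{h}}$, the following hold. 1. $i_H(n) = g(n,h)$. Furthermore, the $n$-vertex graphs $G$ with $i_H(G) = i_H(n)$ are precisely (up to isomorphism) the nested balanced blowups of $H$ on $n$ vertices, i.e. the elements of $H^*(n)$. 2. If $n\ge h$ and $G$ is an $n$-vertex graph with $i_H(G) \ge f(n,h)$, then $G$ is (up to isomorphism) obtained from a balanced blowup of $H$ on $n$ vertices by adding some (possibly no) edges inside the blowup parts.
   Context: All graphs are finite and simple; $[h]=\{1,\dots,h\}$; all logarithms are base $2$; $H[S]$ is the subgraph of $H$ induced by $S$. $i_H(G)$ is the number of induced copies of $H$ in $G$, and $i_H(n)$ is the maximum of $i_H(G)$ over all graphs $G$ with $n$ vertices. **The functions $f,g$.** An $(h,n)$-partition is a sequence of nonnegative integers $a_1,\dots,a_h$ with sum $n$; it is equitable if any two elements differ by at most $1$. $f(n,h)=\prod_{i=1}^h a_i$ where $a_1,\dots,a_h$ is an equitable $(h,n)$-partition. $g(n,h)=0$ for $n<h$, and for $n\ge h$, $g(n,h)=f(n,h)+\sum_{i=1}^h g(a_i,h)$ where $a_1,\dots,a_h$ is an equitable $(h,n)$-partition. **Blowups.** For a graph $F$ with vertices $v_1,\dots,v_s$ and positive integers $a_1,\dots,a_s$, the blowup $F(a_1,\dots,a_s)$ has as vertex set the disjoint union of independent sets (parts) $A_1,\dots,A_s$ with $|A_i|=a_i$; for $i\ne j$,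 all pairs between $A_i$ and $A_j$ are edges if $v_iv_j\in E(F)$, and none are edges otherwise. For $H$ on $h$ vertices and $n\ge h$, a balanced blowup of $H$ on $n$ vertices is a blowup $H(a_1,\dots,a_h)$ with $a_1,\dots,a_h$ an equitable $(h,n)$-partition. A pair of distinct vertices of a blowup is a part pair if both lie in the same part, and a blowup pair otherwise. Changing a pair means turning an edge into a non-edge or vice versa. **Nested balanced blowups.** For $n<h$, $H^*(n)$ is the set of all graphs on $n$ vertices. For $n\ge h$, $H^*(n)$ is the set of all graphs obtained by taking a balanced blowup of $H$ on $n$ vertices with parts $A_1,\dots,A_h$, $|A_i|=a_i$, and replacing each independent set $A_i$ with some element of $H^*(a_i)$ (different elements may be used for different parts of the same size). **Closeness.** Let $B$ be a blowup of some graph and $B'$ a graph of the same order. $B$ is blowup $m$-close to $B'$ if one can change at most $m$ blowup pairs of $B$ and arbitrarily change part pairs of $B$ so that the resulting graph is isomorphic to $B'$; otherwise it is blowup $m$-far from $B'$. For graphs $H_1,H_2$ of the same order and a bijection $\pi:V(H_1)\to V(H_2)$, $\pi$ is $m$-close to an isomorphism between $H_1$ and $H_2$ if one can change at most $m$ pairs of $H_1$ so that $\pi$ is an isomorphism from the obtained graph to $H_2$; otherwise $\pi$ is $m$-far from an isomorphism. A stationary point of $\pi$ is a vertex $v$ with $\pi(v)=v$. **Agreement and distinguishing sets.** For $S\subset V(H)$, the agreement set $A(S)$ is the set of vertices $w\in V(H)\setminus S$ that are either adjacent to all vertices of $S$ or non-adjacent to all vertices of $S$. A set $Q\subset V(H)$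 is distinguishing if $Q$ is not contained in the agreement set of any two vertices outside $Q$. **Strongly asymmetric graphs.** A graph $H$ on vertex set $[h]$ is strongly asymmetric ($H\in\mathcal{P}_h$) if all of the following hold: 1. Every vertex degree is larger than $0.4h$ and smaller than $0.6h$. 2. The agreement set of every pair of vertices has order at most $0.55h$, and the agreement set of every triple of vertices has order at most $0.3h$. 3. $H$ has a distinguishing set of order at most $3\log h$. 4. For every $S\subset[h]$ with $|S|\le 0.7h$, every blowup $B$ of $H[S]$ with at least $0.8h$ and at most $h$ vertices in which each part has at most $h/100$ vertices, and every $K\subseteq[h]$ (with $|K|=|V(B)|$, as needed for the comparison), $B$ is blowup $10^{-5}h^2$-far from $H[K]$. 5. For all $J,K\subset[h]$ with $|J|=|K|=\lceil 0.7h\rceil$ and every bijection $\pi:J\to K$ with at least $0.1h$ non-stationary points, $\pi$ is $10^{-5}h^2$-far from an isomorphism between $H[J]$ and $H[K]$. *)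

(* Defs.v *)
From HB Require Import structures.
From mathcomp Require Import all_boot all_order all_algebra.
From mathcomp Require Import zify.
From mathcomp Require Import boolp reals exp.

Set Implicit Arguments.
Unset Strict Implicit.
Unset Printing Implicit Defensive.

Import Order.TTheory GRing.Theory Num.Theory.

Record graph (V : finType) := Graph {
  edges : {set {set V}};
  _ : [forall e in edges, #|e| == 2] }.

HB.instance Definition _ (V : finType) := [isSub for @edges V].
HB.instance Definition _ (V : finType) := [Countable of graph V by <:].
HB.instance Definition _ (V : finType) := [Finite of graph V by <:].

Definition adj (V : finType) (G : graph V) : rel V :=
  [rel x y | [set x; y] \in edges G].

Lemma adj_sym (V : finType) (G : graph V) : symmetric (adj G).
Proof. by move=> x y; rewrite /adj /= setUC. Qed.

Lemma adj_irr (V : finType) (G : graph V) : irreflexive (adj G).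
Proof.
move=> x; apply/negP; rewrite /adj /= setUid => xG.
by have /forall_inP/(_ _ xG) := valP G; rewrite cards1.
Qed.

Definition rel_edges (V : finType) (r : rel V) : {set {set V}} :=
  [set [set p.1; p.2] | p in [set p : V * V | (p.1 != p.2) && r p.1 p.2]].

Lemma rel_edgesP (V : finType) (r : rel V) :
  [forall e in rel_edges r, #|e| == 2].
Proof.
apply/forall_inP => e /imsetP[[x y]] /=.
by rewrite inE /= => /andP[xy _] ->; rewrite cards2 xy.
Qed.

Definition mk_graph (V : finType) (r : rel V) : graph V :=
  Graph (rel_edgesP r).

Lemma adj_mk_graph (V : finType) (r : rel V) (x y : V) :
  symmetric r -> adj (mk_graph r) x y = (x != y) && r x y.
Proof.
move=> rS; rewrite /adj /=; apply/imsetP/idP => [[[u v]] | /andP[xy rxy]].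
  rewrite inE /= => /andP[uv ruv] E.
  have /set2P xuv : x \in [set u; v] by rewrite -E set21.
  have /set2P yuv : y \in [set u; v] by rewrite -E set22.
  have uxy : u \in [set x; y] by rewrite E set21.
  have vxy : v \in [set x; y] by rewrite E set22.
  case: xuv yuv => Ex [] Ey; subst x y.
  - by rewrite !inE orbb in vxy; rewrite (eqP vxy) eqxx in uv.
  - by rewrite uv ruv.
  - by rewrite eq_sym uv rS ruv.
  - by rewrite !inE orbb in uxy; rewrite (eqP uxy) eqxx in uv.
by exists (x, y) => //; rewrite inE /= xy.
Qed.

Definition is_iso (V W : finType) (f : V -> W) (G : graph V) (G' : graph W) :=
  bijective f /\ forall x y, adj G' (f x) (f y) = adj G x y.

Definition iso (V W : finType) (G : graph V) (G' : graph W) : Prop :=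
  exists f : V -> W, is_iso f G G'.

Definition induced (V : finType) (G : graph V) (S : {set V}) :
    graph {x : V | x \in S} :=
  mk_graph [rel x y | adj G (val x) (val y)].

(* The pairs to be changed to turn [G] into [G']. *)
Definition changed (V : finType) (G G' : graph V) : {set {set V}} :=
  (edges G :\: edges G') :|: (edges G' :\: edges G).

(* Induced copies of [H] are counted as vertex subsets, so [max_ind_copies H n]
   is [i_H(n)]; graphs on ['I_n] represent all graphs with [n] vertices. *)
Definition ind_copies (V W : finType) (H : graph V) (G : graph W) : nat :=
  #|[set S : {set W} | `[< iso (induced G S) H >]]|.

Definition max_ind_copies (V : finType) (H : graph V) (n : nat) : nat :=
  \max_(G : graph 'I_n) ind_copies H G.

Definition equitable_partition (h n : nat) (a : 'I_h -> nat) : Prop :=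
  \sum_(i < h) a i = n /\ forall i j, a i <= (a j).+1.

(* A representative; by [equitable_partition_perm] below, equitable
   partitions are unique up to reordering. *)
Definition eqpart (n h : nat) (i : 'I_h) : nat := n %/ h + (i < n %% h).

Definition f (n h : nat) : nat := \prod_(i < h) eqpart n i.

(* The recursion of [g] terminates for [1 < h], as parts are then smaller than
   [n]; [k] bounds its depth, and [gE] below is the recursive equation. *)
Fixpoint g_rec (k n h : nat) : nat :=
  if k is k'.+1 then
    if n < h then 0 else f n h + \sum_(i < h) g_rec k' (eqpart n i) h
  else 0.

Definition g (n h : nat) : nat := g_rec n.+1 n h.

Lemma equitable_count (h n : nat) (a : 'I_h -> nat) (x : nat) :
  0 < h -> equitable_partition n a ->
  #|[pred i | a i == x]| =
    if x == (n %/ h).+1 then n %% h else if x == n %/ h then h - n %% h else 0.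
Proof.
move=> h0 [an ea].
have [i0 _ mi0] := arg_minnP a (erefl true : xpredT (Ordinal h0)).
set m := a i0 in mi0; set c := #|[pred i | a i == m.+1]|.
have ab i : a i = m + (a i == m.+1).
  by have := ea i i0; have := mi0 i isT; rewrite -/m; case: eqP; lia.
have En : n = m * h + c.
  rewrite -an (eq_bigr _ (fun i _ => ab i)) big_split /= sum_nat_const card_ord.
  by rewrite mulnC /c -sum1_card [in RHS]big_mkcond /=; congr (_ + _).
have cm : c + #|[pred i | a i == m]| = h.
  rewrite -[RHS]card_ord -(cardC [pred i | a i == m.+1]); congr (_ + _).
  by apply: eq_card => i; rewrite !inE; have := ab i; do 2!case: eqP; lia.
have m0 : 0 < #|[pred i | a i == m]|.
  by apply/card_gt0P; exists i0; rewrite inE.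
have ch : c < h by lia.
have -> : n %/ h = m by rewrite En divnMDl // divn_small // addn0.
have -> : n %% h = c by rewrite En modnMDl modn_small.
case: eqP => [->//|xm1]; case: eqP => [->|xm]; first by lia.
by apply: eq_card0 => i; rewrite !inE; have := ab i; do 2!case: eqP; lia.
Qed.

Lemma eqpart_equitable (n h : nat) :
  0 < h -> equitable_partition n (@eqpart n h).
Proof.
move=> h0; split; last by move=> i j; rewrite /eqpart; case: ltnP; case: ltnP; lia.
rewrite big_split /= sum_nat_const card_ord [RHS](divn_eq n h) mulnC.
congr (_ + _); have rh : n %% h <= h by rewrite ltnW // ltn_pmod.
rewrite -(big_mkord xpredT (fun i => nat_of_bool (i < n %% h))).
rewrite (big_cat_nat (leq0n _) rh) /= [X in _ + X]big_nat_cond.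
rewrite [X in _ + X]big1 ?addn0.
  rewrite (eq_big_nat _ _ (F2 := fun=> 1)) => [|i /andP[_ ->]] //.
  by rewrite sum_nat_const_nat subn0 muln1.
by move=> i /andP[/andP[]]; rewrite leqNgt => /negbTE->.
Qed.

Lemma equitable_partition_perm (h n : nat) (a : 'I_h -> nat) :
  0 < h -> equitable_partition n a -> perm_eq (codom a) (codom (@eqpart n h)).
Proof.
move=> h0 ea; apply/allP => x _ /=.
have C b : equitable_partition n b ->
    count_mem x (codom b) = #|[pred i : 'I_h | b i == x]|.
  move=> _; rewrite /codom /image_mem count_map cardE /enum_mem size_filter.
  rewrite -enumT count_filter /=; apply: eq_count => i; by rewrite /= inE andbT.
rewrite !C //; last exact: eqpart_equitable.
by rewrite !(equitable_count x h0 (n := n)) //; apply: eqpart_equitable.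
Qed.

Lemma gE (n h : nat) : 1 < h ->
  g n h = if n < h then 0 else f n h + \sum_(i < h) g (eqpart n i) h.
Proof.
move=> h1.
have G k k' m : m < k -> m < k' -> g_rec k m h = g_rec k' m h.
  elim: k k' m => // k IH [//|k'] m mk mk' /=; case: ltnP => // hm.
  congr (_ + _); apply: eq_bigr => i _.
  suff : eqpart m i < m by move=> ?; apply: IH; lia.
  have := divn_eq m h; have := ltn_pmod m (ltnW h1); have : 0 < m %/ h.
    by rewrite divn_gt0 //; lia.
  by rewrite /eqpart; case: ltnP; nia.
rewrite [LHS]/g [LHS]/=; case: ltnP => // hn; congr (_ + _); apply: eq_bigr => i _.
suff : eqpart n i < n by move=> ?; apply: G; lia.
have := divn_eq n h; have := ltn_pmod n (ltnW h1); have : 0 < n %/ h.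
  by rewrite divn_gt0 //; lia.
by rewrite /eqpart; case: ltnP; nia.
Qed.

Section Blowup.
Variables (V : finType) (F : graph V) (a : V -> nat).

(* The part of [v] is the set of all [Tagged _ x] with [x : 'I_(a v)]. *)
Definition blowup_vertex : finType := {v : V & 'I_(a v)}.

Definition blowup : graph blowup_vertex :=
  mk_graph [rel x y : blowup_vertex | adj F (tag x) (tag y)].

Lemma adj_blowup (x y : blowup_vertex) :
  adj blowup x y = adj F (tag x) (tag y).
Proof.
rewrite adj_mk_graph /=; last by move=> u v; apply: adj_sym.
by case: eqVneq => // ->; rewrite adj_irr.
Qed.

(* Meaningful for two-element sets [e], i.e. pairs of distinct vertices. *)
Definition part_pair (e : {set blowup_vertex}) : bool :=
  [exists v : V, e \subset [set x | tag x == v]].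

(* The blowup with the independent set of [v] replaced by [Gs v]. *)
Definition filled_blowup (Gs : forall v, graph 'I_(a v)) :
    graph blowup_vertex :=
  mk_graph [rel x y : blowup_vertex |
    if tag x == tag y then adj (Gs (tag x)) (tagged x) (tagged_as x y)
    else adj F (tag x) (tag y)].

Lemma adj_filled_blowup (Gs : forall v, graph 'I_(a v)) (x y : blowup_vertex) :
  adj (filled_blowup Gs) x y =
    if tag x == tag y then adj (Gs (tag x)) (tagged x) (tagged_as x y)
    else adj F (tag x) (tag y).
Proof.
rewrite adj_mk_graph /=.
  case: (x =P y) => // ->; rewrite eqxx.
  suff -> : tagged_as y y = tagged y by rewrite adj_irr.
  by case: y => v j; apply: tagged_asE.
move=> [u i] [v j] /=; have [uv|_] := eqVneq u v; last exact: adj_sym.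
subst v.
have E k l : tagged_as (existT (fun v => 'I_(a v)) u k) (existT _ u l) = l.
  exact: tagged_asE.
by rewrite !E adj_sym.
Qed.

Definition blowup_plus_part_edges (G : graph blowup_vertex) : Prop :=
  edges blowup \subset edges G /\
  forall e, e \in edges G :\: edges blowup -> part_pair e.

Definition blowup_close (R : realType) (m : R) (W : finType) (B' : graph W) :
    Prop :=
  exists B1 : graph blowup_vertex,
    (#|[set e in changed blowup B1 | ~~ part_pair e]|%:R <= m)%R /\ iso B1 B'.

Definition blowup_far (R : realType) (m : R) (W : finType) (B' : graph W) :
    Prop :=
  ~ blowup_close m B'.

End Blowup.

(* [nested_blowup H G] : the graph [G] belongs, up to isomorphism, to [H^*(n)]. *)
Inductive nested_blowup (h : nat) (H : graph 'I_h) :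
    forall n : nat, graph 'I_n -> Prop :=
| nested_small (n : nat) (G : graph 'I_n) :
    n < h -> nested_blowup H G
| nested_step (n : nat) (G : graph 'I_n) (a : 'I_h -> nat)
    (Gs : forall i, graph 'I_(a i)) :
    h <= n -> equitable_partition n a ->
    (forall i, nested_blowup H (Gs i)) ->
    iso G (filled_blowup H Gs) -> nested_blowup H G.

Definition map_close (R : realType) (m : R) (V W : finType) (p : V -> W)
    (H1 : graph V) (H2 : graph W) : Prop :=
  exists H1' : graph V,
    (#|changed H1 H1'|%:R <= m)%R /\ is_iso p H1' H2.

Definition map_far (R : realType) (m : R) (V W : finType) (p : V -> W)
    (H1 : graph V) (H2 : graph W) : Prop :=
  ~ map_close m p H1 H2.

Definition agreement (V : finType) (H : graph V) (S : {set V}) : {set V} :=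
  [set w in ~: S |
    [forall v in S, adj H w v] || [forall v in S, ~~ adj H w v]].

Definition distinguishing (V : finType) (H : graph V) (Q : {set V}) : Prop :=
  forall x y, x != y -> x \notin Q -> y \notin Q ->
    ~~ (Q \subset agreement H [set x; y]).

Local Open Scope ring_scope.

Definition log2 (R : realType) (x : R) : R := ln x / ln 2.

Record strongly_asymmetric (R : realType) (h : nat) (H : graph 'I_h) : Prop :=
  StronglyAsymmetric {
  sa_degree : forall v : 'I_h,
    4 / 10 * h%:R < #|[set w | adj H v w]|%:R :> R /\
    #|[set w | adj H v w]|%:R < 6 / 10 * h%:R :> R ;
  sa_agreement_pair : forall S : {set 'I_h}, #|S| = 2%N ->
    #|agreement H S|%:R <= 55 / 100 * h%:R :> R ;
  sa_agreement_triple : forall S : {set 'I_h}, #|S| = 3%N ->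
    #|agreement H S|%:R <= 3 / 10 * h%:R :> R ;
  sa_distinguishing : exists Q : {set 'I_h},
    distinguishing H Q /\ #|Q|%:R <= 3 * log2 h%:R :> R ;
  sa_blowup_far : forall (S : {set 'I_h}) (a : {x : 'I_h | x \in S} -> nat)
      (K : {set 'I_h}),
    #|S|%:R <= 7 / 10 * h%:R :> R ->
    (forall v, (0 < a v)%N) ->
    (forall v, (a v)%:R <= h%:R / 100 :> R) ->
    8 / 10 * h%:R <= #|blowup_vertex a|%:R :> R ->
    (#|blowup_vertex a| <= h)%N ->
    #|K| = #|blowup_vertex a| ->
    blowup_far (induced H S) a (h%:R ^+ 2 / 10 ^+ 5 : R) (induced H K) ;
  sa_map_far : forall (J K : {set 'I_h})
      (p : {x : 'I_h | x \in J} -> {x : 'I_h | x \in K}),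
    (#|J| : int) = Num.ceil (7 / 10 * h%:R : R) ->
    (#|K| : int) = Num.ceil (7 / 10 * h%:R : R) ->
    bijective p ->
    h%:R / 10 <= #|[set v | val (p v) != val v]|%:R :> R ->
    map_far (h%:R ^+ 2 / 10 ^+ 5 : R) p (induced H J) (induced H K) }.

(* Main.v *)
Require Import Defs.
From mathcomp Require Import all_boot all_order all_algebra.
From mathcomp Require Import zify lra.
From mathcomp Require Import boolp reals exp.

(** Let [G] have [n] vertices and at least [f n h] copies of [H]. Fixing the most
    popular embedding of a small distinguishing set [Q] costs only a factor
    [n ^ #|Q| = 2 ^ o(h)] and assigns to each vertex of [G] a unique role in
    ['I_h]; since a product of part sizes loses a factor 2 whenever about [n / h]
    vertices are lost, all but [o(n)] vertices conflict with only [o(n)] others.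
    Hence all but a [2 ^ - h] fraction of the copies contain few conflicts, and
    for those the blowup and map conditions on [H] force almost every vertex of
    [H] to be placed in its own part. By induction on [n] every vertex lies in
    many copies, so it fits one, and only one, role with respect to almost all of
    [G]. For the new roles all but a fraction [n ^ -6] of the copies are
    transversals in the right roles; unequal part sizes or a single wrong pair
    would lose a fraction [n ^ -2]. So [G] is a balanced blowup with edges added
    inside the parts, and as [H] has no nontrivial module, the remaining copies
    of [H] lie inside the parts. *)

Set Implicit Arguments.
Unset Strict Implicit.
Unset Printing Implicit Defensive.

(** * The function [f] *)

(** Denominators are cleared throughout: [#|C| * n ^ 9 <= f n h] says that [C] is at most a fraction
    [n ^ -9] of [f n h]. The quantitative input on [n] is [n ^ (A * (#|Q| + 9)) <= 2 ^ h], and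
    [deficit] exploits it: if [F ^ A <= 2 ^ h], a loss of a factor [F] in the product leaves out at
    most [4 * n / A] vertices. The first roles are certified only on a fraction [n ^ - #|Q|] of the
    copies, while almost all copies must be controlled. Hence arbitrary sequences of vertices are
    counted, each bad entry with weight [M]. The constant [M] is so large that [k] bad entries, for
    [k] a small multiple of [h], outweigh [32 ^ h]. A surviving copy may still be wrong in fewer
    than [ee] positions, whose choice costs a factor [2 ^ (30 * ee)]; a vertex in a role that it
    does not fit loses more than [2 ^ (h / 1025)], so [ee] is a still smaller multiple of [h] than
    this allows. Counting all copies says nothing about a single exceptional vertex; the induction
    on [n] supplies the copies through each vertex. *)

Lemma eqpartS (n h : nat) (i : 'I_h) :
  eqpart n.+1 i = eqpart n i + (i == n %% h :> nat).
Proof.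
have h0 : 0 < h by case: i => m; case: h.
have ih := ltn_ord i; rewrite /eqpart; have rh := ltn_pmod n h0.
have E := divn_eq n h.
have [rS|rS] := eqVneq (n %% h).+1 h.
  have -> : n.+1 %/ h = (n %/ h).+1.
    by rewrite {1}E -addnS rS -mulSnr mulnK.
  have -> : n.+1 %% h = 0 by rewrite {1}E -addnS rS -mulSnr modnMl.
  by rewrite ltn0; case: ltngtP; lia.
have rS' : (n %% h).+1 < h by rewrite ltn_neqAle rS.
have -> : n.+1 %/ h = n %/ h.
  by rewrite {1}E -addnS divnMDl // (divn_small rS') addn0.
have -> : n.+1 %% h = (n %% h).+1.
  by rewrite {1}E -addnS modnMDl (modn_small rS').
by rewrite ltnS; case: ltngtP; rewrite ?addn0.
Qed.

(** Only the part of index [n %% h] grows, from [n %/ h] to its successor. In this multiplied form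
    the identity also covers [n < h], where both sides vanish. *)
Lemma f_succ (n h : nat) : 0 < h -> f n.+1 h * (n %/ h) = f n h * (n %/ h).+1.
Proof.
move=> h0; pose i0 : 'I_h := Ordinal (ltn_pmod n h0).
rewrite /f (bigD1 i0) //= [in RHS](bigD1 i0) //=.
have -> : eqpart n.+1 i0 = (n %/ h).+1.
  by rewrite eqpartS /eqpart /= ltnn eqxx addn0 addn1.
have -> : eqpart n i0 = n %/ h by rewrite /eqpart /= ltnn addn0.
rewrite mulnAC [RHS]mulnAC; congr (_ * _); first by rewrite mulnC.
apply: eq_bigr => i; rewrite -val_eqE /= eqpartS => /negbTE ->.
by rewrite addn0.
Qed.

Lemma f_gt0 (n h : nat) : 0 < h -> h <= n -> 0 < f n h.
Proof.
move=> h0 hn; rewrite /f prodn_gt0 // => i.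
by rewrite /eqpart; have : 0 < n %/ h by [rewrite divn_gt0]; lia.
Qed.

Lemma f_small (n h : nat) : n < h -> f n h = 0.
Proof.
move=> nh; rewrite /f (bigD1 (Ordinal nh)) //= /eqpart divn_small //=.
by rewrite modn_small // ltnn mul0n.
Qed.

Lemma f_diag (h : nat) : 0 < h -> f h h = 1.
Proof.
move=> h0; rewrite /f big1 // => i _.
by rewrite /eqpart divnn h0 modnn ltn0.
Qed.

Lemma f_mono (h m n : nat) : m <= n -> f m h <= f n h.
Proof.
elim: n => [|n IH]; first by rewrite leqn0 => /eqP ->.
rewrite leq_eqVlt => /orP[/eqP->//|]; rewrite ltnS => /IH /leq_trans; apply.
by rewrite /f; apply: leq_prod => i _; rewrite eqpartS leq_addr.
Qed.

(** Induction on the sum, taking one unit from a largest part [x]. Since [x] exceeds [q = m %/ h],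
    the product shrinks by a ratio [x / (x - 1)] of at most [(q + 1) / q], which is the growth of
    [f] in [f_succ]. *)
Lemma prod_le_f (h n : nat) (a : 'I_h -> nat) : 0 < h ->
  \sum_i a i <= n -> \prod_i a i <= f n h.
Proof.
move=> h0; move Em : (\sum_i a i) => m mn.
apply: leq_trans (f_mono h mn); clear n mn.
elim: m a Em => [|m IH] a Em.
  rewrite (bigD1 (Ordinal h0)) //=.
  have -> : a (Ordinal h0) = 0; last by rewrite mul0n.
  have := Em; rewrite (bigD1 (Ordinal h0)) //=; lia.
pose i0 := [arg max_(i > Ordinal h0) a i].
have mi0 j : a j <= a i0 by rewrite /i0; case: arg_maxnP => //= i _; apply.
have a0 : m.+1 <= a i0 * h.
  rewrite -Em mulnC -[X in X * _]card_ord -sum_nat_const.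
  by apply: leq_sum => j _; apply: mi0.
set x := a i0 in mi0 a0; set P := \prod_(i | i != i0) a i.
have EP : \prod_i a i = x * P by rewrite (bigD1 i0).
have xk : (m %/ h).+1 <= x.
  by rewrite ltn_divLR.
pose b i := if i == i0 then x.-1 else a i.
have Eb : \prod_i b i = x.-1 * P.
  rewrite (bigD1 i0) //= /b eqxx; congr (_ * _).
  by apply: eq_bigr => i /negbTE ->.
have Sb : \sum_i b i = m.
  move: Em; rewrite (bigD1 i0) //= -/x => Em; rewrite (bigD1 i0) //= {1}/b eqxx.
  rewrite (eq_bigr a); last by move=> i /negbTE; rewrite /b => ->.
  lia.
have := IH _ Sb; rewrite Eb EP => IHb.
have FS := f_succ m h0.
have [k0|k0] := posnP (m %/ h); last first.
  have xx : 0 < x.-1 * (m %/ h).+1 by lia.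
  rewrite -(leq_pmul2r xx).
  have -> : x * P * (x.-1 * (m %/ h).+1) = (x * (m %/ h).+1) * (x.-1 * P) by lia.
  apply: (leq_trans (leq_mul (leqnn _) IHb)).
  have -> : x * (m %/ h).+1 * f m h = x * (f m h * (m %/ h).+1) by lia.
  rewrite -FS.
  have -> : x * (f m.+1 h * (m %/ h)) = f m.+1 h * (x * (m %/ h)) by lia.
  rewrite leq_mul2l; apply/orP; right; nia.
(* Here [q = 0] and [f_succ] carries no information. Either all parts are at most 1, and some part
   is 0 unless the sum is [h]; or [x >= 2], and the induction hypothesis with [f m h = 0] makes the
   remaining product vanish. *)
have mh : m < h by rewrite -[m < h]negbK -leqNgt -divn_gt0 // k0.
have [Ex|x1] := eqVneq x 1.
  have : \prod_i a i <= 1.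
    elim/big_ind: _ => // [u v|i _]; first by nia.
    by have := mi0 i; lia.
  rewrite EP => le1; move: mh; rewrite leq_eqVlt => /orP[/eqP Eh|mh].
    by rewrite Eh f_diag.
  suff [i ai] : exists i, a i = 0.
    rewrite -EP (bigD1 i) //= ai mul0n; lia.
  apply: contrapT => na.
  suff : h <= m.+1 by lia.
  rewrite -Em -[X in X <= _]card_ord -sum1_card leq_sum // => i _.
  by rewrite lt0n; apply/eqP => ai; apply: na; exists i.
suff -> : P = 0 by rewrite muln0.
apply/eqP; rewrite -leqn0 leqNgt; apply/negP => P0.
have : x.-1 * P = 0.
  have : f m h = 0 by rewrite f_small.
  lia.
by nia.
Qed.

Lemma expn_le_mono (m n e : nat) : m <= n -> m ^ e <= n ^ e.
Proof. by case: e => // e mn; rewrite leq_exp2r. Qed.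

Lemma bernoulli_nat (c n : nat) : c ^ n.+1 + n.+1 * c ^ n <= c.+1 ^ n.+1.
Proof.
elim: n => [|n IH]; first by rewrite !expn1 expn0 muln1 addn1.
rewrite [X in _ <= X]expnS; apply: leq_trans (leq_mul (leqnn _) IH).
by rewrite !expnS; lia.
Qed.

(** Below [n], each added vertex multiplies [f] by at least [1 + 1 / c], so by Bernoulli [c + 1] of
    them double it. *)
Lemma f_decay (h c m n j : nat) : 0 < h ->
  n %/ h <= c -> m + c.+1 * j <= n -> f m h * 2 ^ j <= f n h.
Proof.
move=> h0 nc.
have step p : p < n -> f p h * c.+1 <= f p.+1 h * c.
  move=> pn; have pc : p %/ h <= c by apply: leq_trans nc; apply/leq_div2r/ltnW.
  have [k0|k0] := posnP (p %/ h).
    by rewrite f_small ?mul0n // -[p < h]negbK -leqNgt -divn_gt0 // k0.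
  rewrite -(leq_pmul2r k0) mulnAC [X in _ <= X]mulnAC f_succ //.
  have := f p h; nia.
have steps p i : p + i <= n -> f p h * c.+1 ^ i <= f (p + i) h * c ^ i.
  elim: i => [|i IH] pin; first by rewrite addn0.
  rewrite !expnS addnS; have /step S : p + i < n by lia.
  have {}IH := IH ltac:(lia).
  rewrite mulnCA; apply: leq_trans (leq_mul (leqnn _) IH) _.
  rewrite mulnA [c.+1 * _]mulnC [X in _ <= X]mulnA; exact: leq_mul.
elim: j m => [|j IH] m mn; first by rewrite muln1 f_mono //; lia.
have E : f m h * 2 <= f (m + c.+1) h.
  have := steps m c.+1 ltac:(lia); have := bernoulli_nat c c.
  have [->|c0] := posnP c; first by rewrite exp1n exp0n //; lia.
  have U0 : 0 < c ^ c.+1 by rewrite expn_gt0 c0.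
  move=> B S; rewrite -(leq_pmul2r U0); apply: leq_trans S.
  rewrite -mulnA leq_mul2l; apply/orP; right; apply: leq_trans B.
  by rewrite mul2n -addnn leq_add2l [X in X <= _]expnS leq_mul2r leqnSn orbT.
rewrite expnS mulnA; apply: leq_trans (IH (m + c.+1) _); last by lia.
by rewrite leq_mul2r E orbT.
Qed.

(** Removing [x] vertices halves [f] about [x * h / n] times, and [F ^ A <= 2 ^ h] permits at most
    [h / A] halvings. Rounding [j] up and [n %/ h] up costs a factor 2 each, whence the 4. *)
Lemma deficit (h n A F x : nat) : 0 < h -> h <= n -> A <= h -> F ^ A <= 2 ^ h ->
  f n h <= F * f (n - x) h -> A * x <= 4 * n.
Proof.
move=> h0 hn Ah FA fn; have fn0 := f_gt0 h0 hn.
have xn : x <= n.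
  rewrite leqNgt; apply/negP => nx; move: fn.
  have /eqP -> : n - x == 0 by rewrite subn_eq0 ltnW.
  by rewrite (@f_small 0) // muln0 leqNgt fn0.
set c := n %/ h; have E := divn_eq x c.+1; set j := x %/ c.+1 in E.
have /f_decay : n - x + c.+1 * j <= n by lia.
move=> /(_ h h0 (leqnn _)) D.
have f0 : 0 < f (n - x) h.
  by rewrite lt0n; apply/eqP => E0; move: fn; rewrite E0 muln0; lia.
have jF : 2 ^ j <= F.
  by rewrite -(leq_pmul2l f0) [X in _ <= X]mulnC (leq_trans D).
have jA : j * A <= h.
  rewrite -(@leq_exp2l 2) // expnM; apply: leq_trans FA.
  by have [->|A0] := posnP A; rewrite ?expn0 // leq_exp2r.
have xj : x <= c.+1 * j.+1.
  by have := ltn_pmod x (ltn0Sn c); lia.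
have ch : c.+1 * h <= 2 * n.
  by rewrite mulSn; have := leq_trunc_div n h; rewrite -/c; lia.
have : A * x <= c.+1 * (j * A + A).
  by rewrite (leq_trans (leq_mul (leqnn A) xj)) //; lia.
move=> /leq_trans; apply; apply: (@leq_trans (c.+1 * (2 * h))); last by lia.
by rewrite leq_mul2l; apply/orP; right; lia.
Qed.

Lemma f_double (n h : nat) : 0 < h -> h <= n -> f (2 * n) h <= 4 ^ h * f n h.
Proof.
move=> h0 hn; rewrite -[X in 4 ^ X]card_ord -prod_nat_const -big_split /=.
apply: leq_prod => i _; rewrite /eqpart.
have q0 : 0 < n %/ h by rewrite divn_gt0.
have : 2 * n %/ h <= 2 * (n %/ h) + 1.
  by rewrite -ltnS ltn_divLR //; have := divn_eq n h; have := ltn_pmod n h0; nia.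
lia.
Qed.

Lemma expn_le_f (n h : nat) : 0 < h -> h <= n -> n ^ h <= (2 * h) ^ h * f n h.
Proof.
move=> h0 hn; rewrite -[X in n ^ X]card_ord -[X in _ <= (2 * h) ^ X * _]card_ord.
rewrite -!prod_nat_const -big_split /=.
apply: leq_prod => i _; rewrite /eqpart.
have q0 : 0 < n %/ h by rewrite divn_gt0.
by have := divn_eq n h; have := ltn_pmod n h0; nia.
Qed.

(** * Factorial and binomial estimates *)

Lemma ffact_le_expn (n m : nat) : n ^_ m <= n ^ m.
Proof.
elim: m n => [|m IH] n; first by rewrite ffactn0.
rewrite ffactnS expnS leq_mul2l; apply/orP; right.
by apply: leq_trans (IH _) _; case: m {IH} => // m; rewrite leq_exp2r // leq_pred.
Qed.

Lemma bin_le_exp2 (n m : nat) : 'C(n, m) <= 2 ^ n.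
Proof.
have [mn|nm] := leqP m n; last by rewrite bin_small.
have := expnDn 1 1 n; rewrite addn1 => ->.
rewrite (bigD1 (Ordinal (mn : m < n.+1))) //= !exp1n !muln1; exact: leq_addr.
Qed.

Lemma expn_le_fact (n : nat) : n ^ n <= 4 ^ n * n`!.
Proof.
have : n ^ n <= (2 * n) ^_ n.
  have E k : k <= n -> n ^ k <= (2 * n) ^_ k.
    elim: k => [|k IH] kn //; rewrite expnSr ffactnSr leq_mul ?IH //; lia.
  exact: E.
move=> /leq_trans; apply; rewrite -bin_ffact leq_mul2r.
by rewrite (leq_trans (bin_le_exp2 _ _)) ?orbT // expnM.
Qed.

Lemma bin_le_div (n e : nat) : 'C(n, e) * e ^ e <= (4 * n) ^ e.
Proof.
apply: leq_trans (leq_mul (leqnn _) (expn_le_fact e)) _.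
by rewrite mulnCA bin_ffact expnMn leq_mul2l ffact_le_expn orbT.
Qed.

(** * The size of [n] against [2 ^ h] *)

Section Slack.
Import Order.TTheory GRing.Theory Num.Theory.

Lemma poly_le_exp2 (A : nat) :
  exists q0, forall q, q0 <= q -> (A * (q + 9)) ^ 6 <= 2 ^ q.
Proof.
exists (12 * (33 * A)).+1 => q qq0; pose w := q %/ 12.
have wA : 33 * A <= w by rewrite /w leq_divRL //; lia.
apply: (@leq_trans ((2 ^ (2 * w)) ^ 6)); last first.
  by rewrite -expnM leq_exp2l // /w; lia.
rewrite leq_exp2r //; apply: (@leq_trans (w.+1 * w.+1)).
  apply: (@leq_trans (33 * A * w.+1)); last by rewrite leq_mul2r ltnW ?orbT.
  rewrite (mulnC 33) -mulnA leq_mul2l; apply/orP; right; rewrite /w; lia.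
by rewrite mul2n -addnn expnD leq_mul // ltn_expl.
Qed.

(** Put [m = A * (q + 9)]. It suffices that [m ^ 2 <= h], for then
    [n ^ m <= 2 ^ (m * sqrt h) <= 2 ^ h]. For bounded [q] this is the choice of [h0]; otherwise
    [m ^ 6 <= 2 ^ q <= h ^ 3], the last step being the bound [3 * log2 h] on [q]. *)
Lemma slack (R : realType) (A : nat) :
  exists h0 : nat, forall h n q : nat, h0 <= h ->
  (n%:R <= 2 `^ Num.sqrt h%:R :> R)%R -> (q%:R <= 3 * log2 h%:R :> R)%R ->
  n ^ (A * (q + 9)) <= 2 ^ h.
Proof.
have [q0 q0P] := poly_le_exp2 A; exists (maxn 1 ((A * (q0 + 9)) ^ 2)) => h n q.
rewrite geq_max => /andP[h1 hq0] nh qh.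
have Aq : (A * (q + 9)) ^ 2 <= h.
  have [qq|qq] := leqP q q0.
    apply: leq_trans hq0; rewrite leq_exp2r // leq_mul2l; apply/orP; right; lia.
  rewrite -(@leq_exp2r _ _ 3) // -expnM.
  apply: leq_trans (q0P q (ltnW qq)) _.
  have h0R : (0 < h%:R :> R)%R by rewrite ltr0n.
  rewrite -(ler_nat R) !natrX -ler_ln ?posrE ?exprn_gt0 // !lnXn //.
  move: qh; rewrite /log2 mulrA ler_pdivlMr ?ln_gt0 ?ltr1n //.
  by rewrite mulr_natl mulr_natl.
rewrite -(ler_nat R) !natrX.
apply: (@le_trans _ _ ((2 `^ Num.sqrt h%:R) ^+ (A * (q + 9)))%R).
  by apply: lerXn2r => //; rewrite nnegrE ?powR_ge0.
rewrite -powR_mulrn ?powR_ge0 // -powRrM -[X in (_ <= X)%R]powR_mulrn //.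
rewrite ler_powR ?ler1n //.
have s0 : (0 <= Num.sqrt h%:R :> R)%R := sqrtr_ge0 _.
rewrite -[X in (_ <= X)%R](@sqr_sqrtr _ h%:R) // expr2 ler_wpM2l //.
by rewrite -(@ler_pXn2r _ 2) ?nnegrE // sqr_sqrtr // -natrX ler_nat.
Qed.

End Slack.

(** * Copies and embeddings *)

Lemma adj_induced (V : finType) (G : graph V) (S : {set V})
    (x y : {x : V | x \in S}) :
  adj (induced G S) x y = adj G (val x) (val y).
Proof.
rewrite adj_mk_graph /=; last by move=> u v; apply: adj_sym.
by case: eqVneq => // ->; rewrite adj_irr.
Qed.

Definition is_emb (V W : finType) (H : graph V) (G : graph W) (X : {set W})
    (p : {ffun V -> W}) : bool :=
  [&& injectiveb p, p @: setT == X &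
      [forall i, forall j, adj G (p i) (p j) == adj H i j]].

Lemma is_embP (V W : finType) (H : graph V) (G : graph W) (X : {set W})
    (p : {ffun V -> W}) :
  reflect [/\ injective p, p @: setT = X &
             forall i j, adj G (p i) (p j) = adj H i j]
          (is_emb H G X p).
Proof.
apply: (iffP and3P) => [[/injectiveP pI /eqP pX /forallP pA]|[pI pX pA]].
  by split=> // i j; have /forallP/(_ j)/eqP := pA i.
split; [exact/injectiveP | exact/eqP|].
by apply/forallP => i; apply/forallP => j; rewrite pA.
Qed.

Definition copies (V W : finType) (H : graph V) (G : graph W) :
    {set {set W}} := [set X | [exists p, is_emb H G X p]].

Lemma copiesP (V W : finType) (H : graph V) (G : graph W) (X : {set W}) :
  reflect (exists p, is_emb H G X p) (X \in copies H G).
Proof. by rewrite inE; apply: existsP. Qed.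

Lemma ind_copiesE (V W : finType) (H : graph V) (G : graph W) :
  ind_copies H G = #|copies H G|.
Proof.
apply: eq_card => X; rewrite [LHS]inE; apply/asboolP/copiesP.
  case=> q [[p qK pK] qA].
  exists [ffun i => val (p i)]; apply/is_embP; split=> [i j||i j].
  - by rewrite !ffunE => /val_inj /(can_inj pK).
  - apply/setP => x; apply/imsetP/idP => [[i _ ->]|xX].
      by rewrite ffunE; apply: valP.
    by exists (q (exist _ x xX)); rewrite // ffunE qK.
  - by rewrite !ffunE -adj_induced -qA !pK.
case=> p /is_embP[pI pX pA].
have F (x : {x : W | x \in X}) : exists i, p i == val x.
  have : val x \in p @: setT by rewrite pX; apply: valP.
  by case/imsetP => i _ ->; exists i.
pose q x := xchoose (F x).
have qE x : p (q x) = val x by apply/eqP/(xchooseP (F x)).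
have M i : p i \in X by rewrite -pX imset_f.
exists q; split=> [|x y]; last by rewrite -pA !qE adj_induced.
exists (fun i => exist _ (p i) (M i)) => [x|i]; last by apply: pI; rewrite qE.
by apply: val_inj; rewrite /= qE.
Qed.

Lemma copies_choice (V W : finType) (H : graph V) (G : graph W) :
  W -> exists e : {set W} -> {ffun V -> W},
    forall X, X \in copies H G -> is_emb H G X (e X).
Proof.
move=> x0; exists (fun X => odflt [ffun=> x0] [pick p | is_emb H G X p]) => X.
by case/copiesP => p pX; case: pickP => [//|/(_ p)]; rewrite pX.
Qed.

Lemma card_copy (V W : finType) (H : graph V) (G : graph W) (X : {set W}) :
  X \in copies H G -> #|X| = #|V|.
Proof.
by case/copiesP => p /is_embP[pI <- _]; rewrite card_imset // cardsT.
Qed.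

Lemma card_copies_sub (V T T' : finType) (H : graph V) (G : graph T)
    (G' : graph T') (u : T' -> T) :
  injective u -> (forall x y, adj G (u x) (u y) = adj G' x y) ->
  #|copies H G'| = #|[set X in copies H G | X \subset u @: setT]|.
Proof.
move=> uI uA; rewrite -(card_imset _ (imset_inj uI)); apply: eq_card => X.
rewrite in_set; apply/imsetP/andP => [[X' /copiesP[p /is_embP[pI pX pA]] ->]|].
  split; last by apply: imsetS.
  apply/copiesP; exists [ffun i => u (p i)]; apply/is_embP; split=> [i j||i j].
  - by rewrite !ffunE => /uI/pI.
  - rewrite -pX -imset_comp; apply: eq_imset => i; by rewrite ffunE.
  - by rewrite !ffunE uA pA.
case=> /copiesP[p /is_embP[pI pX pA]] /subsetP Xu.
have F i : exists x, u x == p i.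
  have /Xu/imsetP[x _ ->] : p i \in X by rewrite -pX imset_f.
  by exists x.
pose q i := xchoose (F i).
have qE i : u (q i) = p i by apply/eqP/(xchooseP (F i)).
exists (q @: setT); last first.
  by rewrite -imset_comp -pX; apply: eq_imset => i; rewrite /= qE.
apply/copiesP; exists (finfun q); apply/is_embP; split=> [i j||i j].
- by rewrite !ffunE => qij; apply: pI; rewrite -!qE qij.
- by apply: eq_imset => i; rewrite ffunE.
- by rewrite !ffunE -uA !qE pA.
Qed.

Lemma ind_copies_iso (V T T' : finType) (H : graph V) (G : graph T)
    (G' : graph T') : iso G G' -> ind_copies H G = ind_copies H G'.
Proof.
case=> u [uB uA]; rewrite !ind_copiesE.
rewrite (card_copies_sub H (bij_inj uB) uA); apply: eq_card => X.
rewrite inE; apply: andb_idr => _; apply/subsetP => x _.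
by case: uB => v _ vK; rewrite -(vK x) imset_f.
Qed.

Lemma iso_sym (T T' : finType) (G : graph T) (G' : graph T') :
  iso G G' -> iso G' G.
Proof.
case=> u [[v uK vK] uA]; exists v; split; first by exists u.
by move=> x y; rewrite -uA !vK.
Qed.

Lemma ind_copies_max (h n : nat) (H : graph 'I_h) (G : graph 'I_n) :
  ind_copies H G <= max_ind_copies H n.
Proof. exact: (leq_bigmax (F := ind_copies H)). Qed.

Definition sub_graph (T : finType) (G : graph T) (A : {set T}) :
    graph 'I_#|A| :=
  mk_graph [rel x y | adj G (enum_val x) (enum_val y)].

Lemma adj_sub_graph (T : finType) (G : graph T) (A : {set T}) (x y : 'I_#|A|) :
  adj (sub_graph G A) x y = adj G (enum_val x) (enum_val y).
Proof.
rewrite adj_mk_graph /=; last by move=> u v; apply: adj_sym.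
by case: eqVneq => // ->; rewrite adj_irr.
Qed.

Lemma card_copies_in (V T : finType) (H : graph V) (G : graph T)
    (A : {set T}) :
  #|[set X in copies H G | X \subset A]| = ind_copies H (sub_graph G A).
Proof.
have E : @enum_val _ (mem A) @: setT = A.
  apply/setP => x; apply/imsetP/idP => [[i _ ->]|xA]; first exact: enum_valP.
  by exists (enum_rank_in xA x); rewrite ?enum_rankK_in.
rewrite ind_copiesE -{1}E; symmetry; apply: card_copies_sub.
  exact: enum_val_inj.
by move=> x y; rewrite adj_sub_graph.
Qed.

Lemma copies_in_max (h : nat) (T : finType) (H : graph 'I_h) (G : graph T)
    (A : {set T}) :
  #|[set X in copies H G | X \subset A]| <= max_ind_copies H #|A|.
Proof. by rewrite card_copies_in ind_copies_max. Qed.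

(** * Graphs without nontrivial modules, and copies of them in blowups with filled parts *)

Definition prime_graph (V : finType) (H : graph V) : Prop :=
  forall S : {set V}, 1 < #|S| < #|V| ->
    exists x u v, [/\ x \notin S, u \in S, v \in S & adj H x u != adj H x v].

Definition exact_roles (V T : finType) (H : graph V) (G : graph T) (w : T -> V) :=
  forall x y, w x != w y -> adj G x y = adj H (w x) (w y).

(** The positions of a copy that land in one part form a module of [H]. By primality a copy
    therefore meets every part exactly once or lies inside a single part. *)
Lemma card_copies_exact (V T : finType) (H : graph V) (G : graph T)
    (w : T -> V) :
  1 < #|V| -> prime_graph H -> exact_roles H G w ->
  #|copies H G| = \prod_i #|[set x | w x == i]| +
    \sum_i #|[set X in copies H G | X \subset [set x | w x == i]]|.
Proof.
move=> V1 pH ex.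
pose B := [set X : {set T} | [exists i, X \subset [set x | w x == i]]].
rewrite -(cardsID B) addnC; congr (_ + _).
  pose F := [set p : {ffun V -> T} in family (fun i => [set x | w x == i])].
  have wF p : p \in F -> forall i, w (p i) = i.
    by rewrite inE => /familyP pF i; have := pF i; rewrite inE => /eqP.
  have FI : {in F &, injective (fun p : {ffun V -> T} => p @: setT)}.
    move=> p q pF qF E; apply/ffunP => i.
    have : p i \in q @: setT by rewrite -E imset_f.
    by case/imsetP => j _ pq; rewrite pq -(wF _ pF i) pq (wF _ qF).
  transitivity #|F|; last first.
    by rewrite cardsE card_family foldrE big_map big_enum.
  rewrite -(card_in_imset FI); apply: eq_card => X; rewrite in_setD.
  apply/andP/imsetP => [[XB /copiesP[p /is_embP[pI pX pA]]]|[p pF ->]].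
    have wpI : injective (w \o p).
      move=> a b /= wab; apply: contraNeq XB => ab.
      pose S := [set c | w (p c) == w (p a)].
      have S1 : 1 < #|S|.
        apply: (@leq_trans #|[set a; b]|); first by rewrite cards2 ab.
        apply/subset_leq_card/subsetP => c.
        by rewrite !inE => /orP[] /eqP ->; rewrite ?wab.
      have [SV|SV] := ltnP #|S| #|V|.
        have [|x [u [v [xS uS vS]]]] := pH S; first by rewrite S1.
        move: xS uS vS; rewrite !inE => xS /eqP uS /eqP vS.
        by rewrite -!pA !ex ?uS ?vS // eqxx.
      have ST : S = setT.
        by apply/eqP; rewrite eqEcard subsetT cardsT.
      rewrite inE; apply/existsP; exists (w (p a)); rewrite -pX.
      apply/subsetP => x /imsetP[c _ ->]; rewrite inE.
      have : c \in S by rewrite ST.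
      by rewrite inE.
    have [s sK wK] := injF_bij wpI.
    exists [ffun i => p (s i)].
      by rewrite inE; apply/familyP => i; rewrite ffunE inE; apply/eqP/wK.
    rewrite -pX; apply/setP => x; apply/imsetP/imsetP => [] [i _ ->].
      by exists (w (p i)) => //; rewrite ffunE; have /= -> := sK i.
    by exists (s i); rewrite ?ffunE.
  have pw := wF _ pF; split.
    rewrite inE; apply/existsP => -[i /subsetP pi].
    have E j : j = i.
      have /pi : p j \in p @: setT by rewrite imset_f.
      by rewrite inE pw => /eqP.
    suff : #|V| <= 1 by rewrite leqNgt V1.
    by apply/fintype_le1P => a b; rewrite (E a) (E b).
  apply/copiesP; exists p; apply/is_embP; split=> // [i j /(congr1 w)|i j].
    by rewrite !pw.
  have [->|ij] := eqVneq i j; first by rewrite !adj_irr.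
  by rewrite ex !pw.
rewrite -sum1_card; under [RHS]eq_bigr do rewrite -sum1_card.
rewrite (eq_bigl (fun X => (X \in copies H G) && (X \in B))); last first.
  by move=> X; rewrite inE.
under [RHS]eq_bigr do rewrite (eq_bigl _ _ (in_set _)) big_mkcondr.
rewrite exchange_big big_mkcondr /=; apply: eq_bigr => X XH.
rewrite inE; case: ifPn => [/existsP[i Xi]|]; last first.
  rewrite negb_exists => /forallP XB; rewrite big1 // => i _.
  by rewrite (negbTE (XB i)).
rewrite (bigD1 i) //= Xi big1 // => j ji.
have : 0 < #|X| by rewrite (card_copy XH) ltnW.
case/card_gt0P => x xX; case: ifP => // /subsetP/(_ _ xX).
have /subsetP/(_ _ xX) := Xi.
by rewrite !inE => /eqP -> ij; rewrite eq_sym ij in ji.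
Qed.

(** * Weighted counting of sequences *)

(** [s] is the prefix exposed so far: each entry of [x] is tested against the entries before it. *)
Fixpoint nbad (T : finType) (Bad : seq T -> {set T}) (s x : seq T) : nat :=
  if x is y :: x' then (y \in Bad s) + nbad Bad (rcons s y) x' else 0.

Lemma sum_tupleS (T : finType) (m : nat) (F : seq T -> nat) :
  \sum_(x : m.+1.-tuple T) F x = \sum_(y : T) \sum_(x : m.-tuple T) F (y :: x).
Proof.
rewrite pair_big /=.
rewrite (reindex (fun p : T * m.-tuple T => [tuple of p.1 :: p.2])) //=.
exists (fun x => (thead x, [tuple of behead x])) => [[y x] _|x _] /=.
  by congr (_, _); apply: val_inj.
by rewrite [RHS]tuple_eta.
Qed.

(** An exponential moment bound. Whatever the prefix, the next entry contributes at most
    [M * #|Bad s| + #|T| <= 2 * #|T|]. *)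
Lemma weight_tuples (T : finType) (Bad : seq T -> {set T}) (M h : nat) :
  0 < M -> (forall s, size s < h -> M * #|Bad s| <= #|T|) ->
  forall m s, size s + m <= h ->
  \sum_(x : m.-tuple T) M ^ nbad Bad s x <= (2 * #|T|) ^ m.
Proof.
move=> M0 MB; elim=> [|m IH] s sm.
  rewrite (eq_bigr (fun=> 1)) => [|x _]; last by rewrite (tuple0 x).
  by rewrite sum1_card card_tuple.
rewrite (sum_tupleS _ (fun x => M ^ nbad Bad s x)) /=.
apply: (@leq_trans (\sum_(y : T) M ^ (y \in Bad s) * (2 * #|T|) ^ m)).
  apply: leq_sum => y _; under eq_bigr do rewrite expnD.
  by rewrite -big_distrr leq_mul2l IH ?orbT // size_rcons; lia.
rewrite -big_distrl expnS leq_mul2r; apply/orP; right.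
rewrite (bigID (mem (Bad s))) /=.
rewrite (eq_bigr (fun=> M)) => [|y ->]; last by rewrite expn1.
rewrite [X in _ + X](eq_bigr (fun=> 1)) => [|y /negbTE ->]; last by rewrite expn0.
rewrite sum_nat_const sum1_card; rewrite mulnC mul2n -addnn.
by apply: leq_add; [apply: MB; lia | apply: max_card].
Qed.

Definition regular (T : finType) (Bad : seq T -> {set T}) (h k : nat)
    (X : {set T}) : bool :=
  [exists t : h.-tuple T, [&& all [in X] t, uniq t & nbad Bad [::] t < k]].

(** Markov's inequality. One light ordering makes a set regular, so all [h!] orderings of an
    irregular set have weight at least [M ^ k], and different sets share no ordering. *)
Lemma card_irregular (T : finType) (Bad : seq T -> {set T}) (M h k : nat) :
  0 < M -> (forall s, size s < h -> M * #|Bad s| <= #|T|) ->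
  #|[set X : {set T} | (#|X| == h) && ~~ regular Bad h k X]| * h`! * M ^ k
    <= (2 * #|T|) ^ h.
Proof.
move=> M0 MB; set I := [set X | _].
apply: leq_trans (weight_tuples M0 MB (leqnn h : size [::] + h <= h)).
pose P (X : {set T}) (t : h.-tuple T) := all [in X] t && uniq t.
apply: (@leq_trans (\sum_(X in I) \sum_(t | P X t) M ^ nbad Bad [::] t)).
  rewrite -mulnA -sum_nat_const; apply: leq_sum => X; rewrite inE => /andP[/eqP Xh].
  rewrite negb_exists => /forallP XI.
  rewrite -ffactnn -[X in X ^_ _]Xh -card_uniq_tuples.
  rewrite -sum_nat_const big_mkcond [X in _ <= X]big_mkcond.
  apply: leq_sum => t _; rewrite inE /P; case: ifP => // /andP[tX tu].
  by rewrite leq_pexp2l // leqNgt; have := XI t; rewrite tX tu.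
rewrite (exchange_big_dep xpredT) //=; apply: leq_sum => t _.
rewrite sum_nat_const -[X in _ <= X]mul1n leq_mul2r; apply/orP; right.
rewrite -(cards1 [set x in t]); apply/subset_leq_card/subsetP => X.
rewrite unfold_in /= inE -andbA => /and3P[/eqP Xh _ /andP[/allP tX tu]].
rewrite inE eq_sym eqEcard Xh cardsE (card_uniqP tu) size_tuple leqnn andbT.
by apply/subsetP => x; rewrite inE => /tX.
Qed.

(** * Rigidity of strongly asymmetric graphs *)

Definition pair_count (V : finType) (Y : {set V}) (r : rel V) : nat :=
  \sum_(x in Y) #|[set y in Y | r x y]|.

Lemma pair_countE (V : finType) (Y : {set V}) (r : rel V) :
  pair_count Y r = #|[set p | [&& p.1 \in Y, p.2 \in Y & r p.1 p.2]]|.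
Proof.
rewrite /pair_count (eq_bigr (fun x => \sum_(y | (y \in Y) && r x y) 1)).
  rewrite pair_big_dep /= -sum1_card; apply: eq_bigl => p.
  by rewrite inE.
by move=> x xY; rewrite -sum1_card; apply: eq_bigl => y; rewrite inE.
Qed.

Lemma subset_of_card (V : finType) (S : {set V}) (m : nat) :
  m <= #|S| -> exists2 D : {set V}, D \subset S & #|D| = m.
Proof.
rewrite cardE => mS; exists [set x in take m (enum S)].
  by apply/subsetP => x; rewrite inE => /mem_take; rewrite mem_enum.
rewrite cardsE (card_uniqP _) ?take_uniq ?enum_uniq // size_take.
by case: ltngtP mS => // ->.
Qed.

Lemma pair_count_swap (V : finType) (Y : {set V}) (r : rel V) :
  pair_count Y (fun x y => r y x) = pair_count Y r.
Proof.
have sI : injective (fun p : V * V => (p.2, p.1)) by move=> [a b] [c d] [-> ->].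
rewrite !pair_countE -[RHS](card_imset _ sI).
apply: eq_card => -[i j]; rewrite inE /=; apply/idP/imsetP.
  case/and3P => iY jY rji; exists (j, i) => //=.
  by rewrite inE /= jY iY.
by case=> -[j' i']; rewrite inE /= => /and3P[? ? ?] [-> ->]; apply/and3P.
Qed.

Lemma pair_count_le (V : finType) (Y Z : {set V}) (r s : rel V) :
  Y \subset Z ->
  (forall x y, x \in Y -> y \in Y -> r x y -> s x y) ->
  pair_count Y r <= pair_count Z s.
Proof.
move=> /subsetP YZ rs; rewrite !pair_countE; apply/subset_leq_card/subsetP => -[x y].
by rewrite !inE /= => /and3P[xY yY rxy]; rewrite !YZ // rs.
Qed.

(* Each unordered pair is counted twice on the right. *)
Lemma card_changed_le (V : finType) (G G' : graph V) (P : pred {set V}) :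
  #|[set e in changed G G' | P e]| <=
  #|[set p : V * V | [&& p.1 != p.2, adj G p.1 p.2 != adj G' p.1 p.2
                       & P [set p.1; p.2]]]|.
Proof.
apply: leq_trans (leq_imset_card (fun p : V * V => [set p.1; p.2]) _).
apply/subset_leq_card/subsetP => e; rewrite inE => /andP[eC eP].
have : #|e| == 2.
  move: eC; rewrite !inE => /orP[] /andP[_ eG].
    by have /forall_inP/(_ _ eG) := valP G.
  by have /forall_inP/(_ _ eG) := valP G'.
case/cards2P => x [y [xy Ee]]; apply/imsetP; exists (x, y) => //=.
rewrite inE /= xy -Ee eP andbT /= /adj /= -Ee.
by move: eC; rewrite !inE; do 2!case: (e \in _).
Qed.

Lemma fiber_arith (h c N : nat) :
  h < 100 * c -> 3 <= c -> c * c.-1 <= N -> h ^ 2 < 10 ^ 5 * N.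
Proof.
move=> hc c3 cN; have {}hc : h < 10 ^ 2 * c by lia.
apply: (@leq_trans ((10 ^ 2 * c) ^ 2)); first by rewrite ltn_exp2r.
apply: (@leq_trans (10 ^ 5 * (c * c.-1))); last by rewrite leq_mul2l cN orbT.
rewrite expnMn -expnM [10 ^ 5]expnSr -mulnA leq_mul2l mulnCA -mulnn leq_mul2l.
by apply/orP; right; apply/orP; right; lia.
Qed.

Section Asymmetric.
Import Order.TTheory GRing.Theory Num.Theory.
Variables (R : realType) (h : nat) (H : graph 'I_h).
Hypothesis sa : strongly_asymmetric R H.

(** Pairs identified by [rho] are left out because they become part pairs of a blowup, which may be
    changed for free. *)
Definition wrong (rho : 'I_h -> 'I_h) : rel 'I_h := [rel x y |
  (rho x != rho y) && (adj H x y != adj H (rho x) (rho y))].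

(** The fibres of [rho] turn [Y] into the vertex set of a blowup of [H[rho(Y)]]; changing the
    [wrong] pairs would make it isomorphic to [H[Y]]. *)
Lemma asym_blowup_far (Y : {set 'I_h}) (rho : 'I_h -> 'I_h) :
  8 * h <= 10 * #|Y| ->
  (forall i, 100 * #|[set y in Y | rho y == i]| <= h) ->
  10 * #|rho @: Y| <= 7 * h -> h ^ 2 < 10 ^ 5 * pair_count Y (wrong rho).
Proof.
move=> Yh fib Sh; rewrite ltnNge; apply/negP => W.
pose S := rho @: Y; pose F i := [set y in Y | rho y == i].
pose a (v : {x | x \in S}) := #|F (val v)|.
have FY (v : {x | x \in S}) (i : 'I_(a v)) : enum_val i \in Y.
  by have := enum_valP i; rewrite inE => /andP[].
have Fv (v : {x | x \in S}) (i : 'I_(a v)) : rho (enum_val i) = val v.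
  by have := enum_valP i; rewrite inE => /andP[_ /eqP].
pose th (x : blowup_vertex a) : {x | x \in Y} :=
    exist (fun x => x \in Y) _ (FY _ (tagged x)).
have thr x : rho (val (th x)) = val (tag x) by case: x => v i; rewrite /th /= Fv.
have thI : injective th.
  move=> x y E; have /(congr1 (rho \o val)) /= := E; rewrite !Fv => /val_inj.
  case: x y E => [v i] [w j] E /= vw; subst w; congr existT.
  by have /(congr1 val) /= := E => /enum_val_inj.
have thS z : exists x, th x = z.
  have zS : rho (val z) \in S by rewrite imset_f //; apply: valP.
  have zF : val z \in F (rho (val z)) by rewrite inE eqxx andbT; apply: valP.
  pose v : {x | x \in S} := exist (fun x => x \in S) _ zS.
  exists (existT (fun v => 'I_(a v)) v (enum_rank_in zF (val z))).
  by apply: val_inj; rewrite /= enum_rankK_in.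
have thB : bijective th.
  apply: inj_card_bij => //; rewrite -(card_imset _ thI).
  rewrite (_ : th @: _ = setT) ?cardsT //; apply/setP => z; rewrite inE.
  by have [x <-] := thS z; rewrite imset_f.
have cardB : #|blowup_vertex a| = #|Y|.
  by rewrite (bij_eq_card thB) card_sig; apply: eq_card.
pose B1 : graph (blowup_vertex a) :=
  mk_graph [rel x y | adj H (val (th x)) (val (th y))].
have B1A x y : adj B1 x y = adj H (val (th x)) (val (th y)).
  rewrite adj_mk_graph /=; last by move=> u v; apply: adj_sym.
  by case: eqVneq => // ->; rewrite adj_irr.
apply: (sa_blowup_far sa (S := S) (a := a) (K := Y)).
- have : ((10 * #|S|)%:R <= (7 * h)%:R :> R)%R by rewrite ler_nat.
  by rewrite !natrM; lra.
- case=> v vS; rewrite /a /= card_gt0; apply/set0Pn.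
  by have /imsetP[y yY Ev] := vS; exists y; rewrite inE yY Ev eqxx.
- move=> v; have : ((100 * a v)%:R <= h%:R :> R)%R by rewrite ler_nat fib.
  by rewrite natrM; lra.
- have : ((8 * h)%:R <= (10 * #|Y|)%:R :> R)%R by rewrite ler_nat.
  by rewrite cardB !natrM; lra.
- by rewrite cardB -[X in _ <= X]card_ord max_card.
- by rewrite cardB.
exists B1; split; last first.
  by exists th; split=> // x y; rewrite B1A adj_induced.
have : ((10 ^ 5 * pair_count Y (wrong rho))%:R <= (h ^ 2)%:R :> R)%R.
  by rewrite ler_nat.
rewrite natrM !natrX => W'.
rewrite ler_pdivlMr ?exprn_gt0 //; apply: le_trans W'.
rewrite mulrC ler_wpM2l ?exprn_ge0 // ler_nat.
apply: leq_trans (card_changed_le _ _ _) _; rewrite pair_countE.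
have si : injective (fun p : blowup_vertex a * blowup_vertex a =>
    (val (th p.1), val (th p.2))).
  move=> [x y] [x' y'] E; have Ex := congr1 fst E; have Ey := congr1 snd E.
  by congr (_, _); [apply/thI/val_inj/Ex | apply/thI/val_inj/Ey].
rewrite -(card_imset _ si); apply/subset_leq_card/subsetP => p.
case/imsetP => -[x y]; rewrite !inE /= => /and3P[xy A NP] ->.
rewrite /wrong /= !FY /= !Fv; apply/andP; split.
  apply: contraNneq NP => /val_inj E; apply/existsP; exists (tag x).
  by apply/subsetP => z; rewrite !inE => /orP[] /eqP ->; rewrite ?E.
by move: A; rewrite adj_blowup B1A eq_sym adj_induced.
Qed.

(** The two bounds on [#|K|] express that it is the ceiling of [7h/10]. *)
Lemma asym_map_far (K : {set 'I_h}) (rho : 'I_h -> 'I_h) :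
  {in K &, injective rho} -> 7 * h <= 10 * #|K| < 7 * h + 10 ->
  h <= 10 * #|[set x in K | rho x != x]| ->
  h ^ 2 < 10 ^ 5 * pair_count K (wrong rho).
Proof.
move=> rI /andP[K1 K2] st; rewrite ltnNge; apply/negP => W.
have rK (x : {x | x \in K}) : rho (val x) \in rho @: K.
  by rewrite imset_f //; apply: valP.
pose p x : {x | x \in rho @: K} := exist (fun x => x \in rho @: K) _ (rK x).
have pI : injective p.
  move=> x y /(congr1 val) /= E; apply/val_inj/rI => //; exact: valP.
have CK (m : nat) : m = #|K| -> (m : int) = Num.ceil (7 / 10 * h%:R : R)%R.
  move=> ->; apply/esym/ceil_def; rewrite intrB -!pmulrn.
  have := K1; have := K2; rewrite -(ltr_nat R) -(ler_nat R) natrD !natrM => k2 k1.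
  by apply/andP; split; lra.
apply: (sa_map_far sa (J := K) (K := rho @: K) (p := p)).
- exact: CK.
- by apply: CK; rewrite card_in_imset.
- apply: inj_card_bij => //; rewrite !card_sig /=.
  by rewrite (card_in_imset rI).
- have -> : #|[set v | val (p v) != val v]| = #|[set x in K | rho x != x]|.
    rewrite -(card_imset _ val_inj); apply: eq_card => x; rewrite !inE.
    apply/imsetP/andP => [[v] |[xK rx]]; last first.
      by exists (exist (fun x => x \in K) x xK); rewrite ?inE.
    by rewrite inE /= => rv ->; split=> //; apply: valP.
  have : (h%:R <= (10 * #|[set x in K | rho x != x]|)%:R :> R)%R by rewrite ler_nat.
  by rewrite natrM; lra.
pose H1 : graph {x | x \in K} := mk_graph [rel x y | adj H (rho (val x)) (rho (val y))].
have H1A x y : adj H1 x y = adj H (rho (val x)) (rho (val y)).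
  rewrite adj_mk_graph /=; last by move=> u v; apply: adj_sym.
  by case: eqVneq => // ->; rewrite adj_irr.
exists H1; split; last first.
  split; last by move=> x y; rewrite H1A adj_induced.
  apply: inj_card_bij => //; rewrite !card_sig /=.
  by rewrite (card_in_imset rI).
have : ((10 ^ 5 * pair_count K (wrong rho))%:R <= (h ^ 2)%:R :> R)%R.
  by rewrite ler_nat.
rewrite natrM !natrX => W'.
rewrite ler_pdivlMr ?exprn_gt0 //; apply: le_trans W'.
rewrite mulrC ler_wpM2l ?exprn_ge0 // ler_nat.
rewrite (_ : changed _ _ = [set e in changed (induced H K) H1 | true]); last first.
  by apply/setP => e; rewrite [RHS]in_set andbT.
apply: leq_trans (card_changed_le _ _ _) _; rewrite pair_countE.
have si : injective (fun p : {x | x \in K} * {x | x \in K} => (val p.1, val p.2)).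
  move=> [x y] [x' y'] E; have Ex := congr1 fst E; have Ey := congr1 snd E.
  by congr (_, _); [apply/val_inj/Ex | apply/val_inj/Ey].
rewrite -(card_imset _ si); apply/subset_leq_card/subsetP => q.
case/imsetP => -[x y]; rewrite !inE /= andbT H1A adj_induced => /andP[xy A] ->.
rewrite /wrong /= A andbT (valP x) (valP y) /=.
apply: contraNneq xy => E; apply/eqP/val_inj/rI => //; exact: valP.
Qed.

Definition conflict (rho : 'I_h -> 'I_h) : rel 'I_h := [rel x y | (x != y) &&
  ((rho x == rho y) || (adj H x y != adj H (rho x) (rho y)))].

Lemma asym_agreement (x y : 'I_h) :
  x != y -> 100 * #|agreement H [set x; y]| <= 55 * h.
Proof.
move=> xy; have := sa_agreement_pair sa (S := [set x; y]).
rewrite cards2 xy => /(_ erefl) A.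
by rewrite -(ler_nat R) !natrM; lra.
Qed.

(* The blowup condition forces [rho] to hit many roles; the map condition then
   applies to a transversal of [rho]. *)
Lemma rigidity (Y : {set 'I_h}) (rho : 'I_h -> 'I_h) :
  200 <= h -> 9 * h <= 10 * #|Y| ->
  10 ^ 5 * pair_count Y (conflict rho) <= h ^ 2 ->
  #|[set y in Y | rho y != y]| * h <= 25 * pair_count Y (conflict rho).
Proof.
move=> h200 Yh C; set N := pair_count Y (conflict rho) in C *.
have WN (K : {set 'I_h}) : K \subset Y -> pair_count K (wrong rho) <= N.
  move=> KY; apply: pair_count_le => // x y _ _ /andP[xy A].
  rewrite /conflict /= A orbT andbT; by apply: contraNneq xy => ->.
have fib i : 100 * #|[set y in Y | rho y == i]| <= h.
  set F := [set y in Y | _]; rewrite leqNgt; apply/negP => Fh.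
  (* All pairs inside a fibre conflict, so a fibre with more than [h / 100] elements would already
     exceed the allowed number of conflicts. *)
  have FN : #|F| * #|F|.-1 <= N.
    apply: (@leq_trans (pair_count F (conflict rho))).
      rewrite /pair_count -sum_nat_const; apply: leq_sum => x xF.
      rewrite (cardsD1 x) xF /=; apply/subset_leq_card/subsetP => y.
      rewrite !inE => /and3P[yx yY /eqP yi]; rewrite yY yi eqxx /conflict /=.
      move: xF; rewrite inE => /andP[_ /eqP ->].
      by rewrite yi eqxx eq_sym yx.
    by apply: pair_count_le => //; apply/subsetP => x; rewrite inE => /andP[].
  have F3 : 3 <= #|F| by lia.
  by have := fiber_arith Fh F3 FN; rewrite ltnNge C.
have big : 7 * h < 10 * #|rho @: Y|.
  rewrite ltnNge; apply/negP => small.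
  have := asym_blowup_far (ltac:(lia) : 8 * h <= 10 * #|Y|) fib small.
  rewrite ltnNge; apply/negP; rewrite negbK; apply: leq_trans C.
  by rewrite leq_mul2l WN ?orbT.
have [x0 _] : exists x0 : 'I_h, x0 \in setT.
  by exists (Ordinal (leq_trans (isT : 0 < 200) h200)).
pose c i := odflt x0 [pick y in Y | rho y == i].
have cP i : i \in rho @: Y -> c i \in Y /\ rho (c i) = i.
  case/imsetP => y yY Ei; rewrite /c; case: pickP => [z /andP[zY /eqP]|/(_ y)] //.
  by rewrite yY Ei eqxx.
(* The ceiling of [7h/10], the size that the map condition asks for. *)
pose m := (7 * h + 9) %/ 10.
have mS : m <= #|c @: (rho @: Y)|.
  rewrite card_in_imset; first by rewrite /m; lia.
  by move=> i j /cP[_ ri] /cP[_ rj] E; rewrite -ri E rj.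
have [K /subsetP KS cardK] := subset_of_card mS.
have KP x : x \in K -> exists2 i, i \in rho @: Y & x = c i.
  by case/KS/imsetP => i iY ->; exists i.
have KY : K \subset Y by apply/subsetP => x /KP[i /cP[cY _] ->].
have KI : {in K &, injective rho}.
  by move=> x y /KP[i /cP[_ ri] ->] /KP[j /cP[_ rj] ->]; rewrite ri rj => ->.
have stK : 10 * #|[set x in K | rho x != x]| < h.
  rewrite ltnNge; apply/negP => st.
  have := asym_map_far KI (ltac:(rewrite cardK /m; lia)) st.
  rewrite ltnNge; apply/negP; rewrite negbK; apply: leq_trans C.
  by rewrite leq_mul2l WN ?orbT.
pose P := [set x in K | rho x == x].
have Ph : 6 * h <= 10 * #|P|.
  have := cardsID [set x | rho x == x] K; rewrite cardK.
  have -> : K :&: [set x | rho x == x] = P by apply/setP => x; rewrite !inE.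
  have -> : K :\: [set x | rho x == x] = [set x in K | rho x != x].
    by apply/setP => x; rewrite !inE andbC.
  by rewrite /m; lia.
rewrite -sum_nat_const /N /pair_count big_distrr /=.
apply: (@leq_trans (\sum_(y in [set y in Y | rho y != y])
    25 * #|[set z in Y | conflict rho y z]|)); last first.
  rewrite [X in _ <= X](bigID (fun y => rho y != y)) /=.
  by rewrite (eq_bigl _ _ (in_set _)) leq_addr.
(* A moved [y] conflicts with every fixed point [p] in [P], apart from [y], [rho y] and the
   agreement set of these two. At least [0.6h - 2 - 0.55h] conflicts remain, which is at least
   [h / 25] because [h >= 200]. *)
apply: leq_sum => y; rewrite inE => /andP[yY ry].
set c' := #|_|; suff PS : #|P| <= 2 + #|agreement H [set y; rho y]| + c'.
  have := asym_agreement (ltac:(by rewrite eq_sym) : y != rho y); lia.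
have -> : 2 = #|[set y; rho y]| by rewrite cards2 eq_sym ry.
apply: leq_trans (leq_trans (leq_card_setU _ _) (leq_add (leq_card_setU _ _) (leqnn c'))).
apply/subset_leq_card/subsetP => p; rewrite inE => /andP[pK /eqP rp].
rewrite !inE (subsetP KY) //= /conflict /= rp.
have [//|py] := eqVneq p y; have [//|pry] := eqVneq p (rho y).
rewrite /=; case: (eqVneq (adj H y p) (adj H (rho y) p)) => [E|]; last first.
  by rewrite orbT.
case Ap : (adj H p y); last first.
  suff -> : [forall v in [set y; rho y], ~~ adj H p v] by rewrite orbT.
  apply/forall_inP => v; rewrite !inE => /orP[] /eqP ->; rewrite ?Ap //.
  by rewrite adj_sym -E adj_sym Ap.
suff -> : [forall v in [set y; rho y], adj H p v] by [].
apply/forall_inP => v; rewrite !inE => /orP[] /eqP ->; rewrite ?Ap //.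
by rewrite adj_sym -E adj_sym Ap.
Qed.

(** The complement of a module [S] lies in the agreement set of every subset of [S]. A two-element
    [S] violates the bound on pairs. A larger one leaves at most [0.3h] vertices outside, and an
    outside vertex, adjacent to all or none of [S], violates a degree bound. *)
Lemma asym_prime : 10 <= h -> prime_graph H.
Proof.
move=> h10 S; rewrite card_ord => /andP[S1 Sh]; apply: contrapT => no.
have same x u v : x \notin S -> u \in S -> v \in S -> adj H x u = adj H x v.
  move=> xS uS vS; apply: contrapT => ne; apply: no.
  by exists x, u, v; split=> //; apply/eqP.
have agr (B : {set 'I_h}) : B \subset S -> ~: S \subset agreement H B.
  move=> /subsetP BS; apply/subsetP => x; rewrite inE => xS.
  rewrite !inE; apply/andP; split; first by apply: contraNN xS => /BS.
  have [/exists_inP[v vB xv]|] := boolP [exists v in B, adj H x v].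
    apply/orP; left; apply/forall_inP => u uB.
    by rewrite (same x u v xS (BS _ uB) (BS _ vB)).
  by rewrite negb_exists_in => ->; rewrite orbT.
have cS := cardsC S; rewrite card_ord in cS.
have [x [u [v [xS uS vS uv]]]] : exists x u v, [/\ x \notin S, u \in S, v \in S & u != v].
  have /card_gt1P[u [v [uS vS uv]]] := S1.
  have : 0 < #|~: S| by lia.
  by case/card_gt0P => x; rewrite inE => xS; exists x, u, v.
have [S2|S3] := leqP #|S| 2.
  have A55 := asym_agreement uv.
  have L : #|~: S| <= #|agreement H [set u; v]|.
    by apply/subset_leq_card/agr; rewrite subUset !sub1set uS.
  move: S1 S2 cS A55 L; set a := #|S|; set b := #|~: S|; set c := #|_|; lia.
have [z zS] : exists z, z \in S :\: [set u; v].
  apply/set0Pn; rewrite -card_gt0.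
  have D := cardsID [set u; v] S.
  have : #|S :&: [set u; v]| <= 2.
    by rewrite (leq_trans (subset_leq_card (subsetIr _ _))) // cards2 uv.
  lia.
move: zS; rewrite !inE negb_or => /andP[/andP[zu zv] zS].
have := sa_agreement_triple sa (S := [set z; u; v]).
rewrite setUC.
have -> : #|[set v] :|: ([set z] :|: [set u])| = 3.
  by rewrite cardsU1 cards2 !inE zu eq_sym (negbTE zv) eq_sym (negbTE uv).
move=> /(_ erefl) T.
have L : #|~: S| <= #|agreement H ([set v] :|: ([set z] :|: [set u]))|.
  by apply/subset_leq_card/agr; rewrite !subUset !sub1set vS zS.
have {T} T : 10 * #|~: S| <= 3 * h.
  move: L; rewrite -(ler_nat R) => L.
  by rewrite -(ler_nat R) !natrM; lra.
have [d1 d2] := sa_degree sa x.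
case A : (adj H x u).
  have : #|S| <= #|[set w | adj H x w]|.
    by apply/subset_leq_card/subsetP => w wS; rewrite inE (same x w u).
  rewrite -(ler_nat R) => L'.
  have : (7%:R * h%:R <= 10%:R * #|S|%:R :> R)%R by rewrite -!natrM ler_nat; lia.
  lra.
have : #|[set w | adj H x w]| <= #|~: S|.
  apply/subset_leq_card/subsetP => w; rewrite !inE.
  by apply: contraTN => wS; rewrite (same x w u) // A.
rewrite -(ler_nat R) => L'.
have : (10%:R * #|~: S|%:R <= 3%:R * h%:R :> R)%R by rewrite -!natrM ler_nat; lia.
have : (10 <= h%:R :> R)%R by rewrite (ler_nat R 10).
lra.
Qed.
End Asymmetric.

(** * Stability *)

Lemma sum_fibers (T I : finType) (r : T -> I) (Z : {set T}) :
  \sum_i #|[set x in Z | r x == i]| = #|Z|.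
Proof.
rewrite -[RHS]sum1_card (partition_big r xpredT) //=.
by apply: eq_bigr => i _; rewrite -sum1_card; apply: eq_bigl => x; rewrite inE.
Qed.

Lemma card_bigcup_le (T I : finType) (P : pred I) (F : I -> {set T}) :
  #|\bigcup_(i | P i) F i| <= \sum_(i | P i) #|F i|.
Proof.
elim/big_rec2: _ => [|i m X _ IH]; first by rewrite cards0.
by apply: leq_trans (leq_card_setU _ _) _; rewrite leq_add2l.
Qed.

Lemma nbad_count (T : finType) (Bad : seq T -> {set T}) (s x : seq T) :
  uniq x ->
  nbad Bad s x = count (fun y => y \in Bad (s ++ take (index y x) x)) x.
Proof.
elim: x s => //= y x IH s /andP[yx xu].
rewrite eqxx take0 cats0 IH //; congr (_ + _).
apply: eq_in_count => z zx; case: eqP => [yz|_]; first by rewrite yz zx in yx.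
by rewrite /= cat_rcons.
Qed.

Section Stability.
Variables (R : realType) (h : nat) (H : graph 'I_h).
Hypothesis sa : strongly_asymmetric R H.
Variables (T : finType) (G : graph T) (emb : {set T} -> {ffun 'I_h -> T}).
Hypothesis embP : forall X, X \in copies H G -> is_emb H G X (emb X).
Hypothesis h200 : 200 <= h.
Hypothesis hn : h <= #|T|.

Let n := #|T|.

Let h0 : 0 < h. Proof. exact: leq_trans h200. Qed.
Let n1 : 1 < n. Proof. by apply: leq_trans hn; apply: leq_trans h200. Qed.

Lemma emb_inj X : X \in copies H G -> injective (emb X).
Proof. by move/embP => /is_embP[]. Qed.

Lemma emb_im X : X \in copies H G -> emb X @: setT = X.
Proof. by move/embP => /is_embP[]. Qed.

Lemma emb_adj X : X \in copies H G ->
  forall i j, adj G (emb X i) (emb X j) = adj H i j.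
Proof. by move/embP => /is_embP[]. Qed.

Lemma emb_mem X i : X \in copies H G -> emb X i \in X.
Proof. by move=> XH; rewrite -{2}(emb_im XH) imset_f. Qed.

Lemma emb_onto X x : X \in copies H G -> x \in X -> exists i, emb X i = x.
Proof. by move=> XH; rewrite -{1}(emb_im XH) => /imsetP[i _ ->]; exists i. Qed.

Lemma card_family_le (C : {set {set T}}) (P : 'I_h -> {set T}) :
  C \subset copies H G -> (forall X i, X \in C -> emb X i \in P i) ->
  #|C| <= \prod_i #|P i|.
Proof.
move=> /subsetP CH CP.
have CI : {in C &, injective emb}.
  by move=> X Y /CH XH /CH YH E; rewrite -(emb_im XH) -(emb_im YH) E.
rewrite -(card_in_imset CI).
have <- : #|family P| = \prod_i #|P i|.
  by rewrite card_family foldrE big_map big_enum.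
apply/subset_leq_card/subsetP => p /imsetP[X XC ->].
by apply/familyP => i; apply: CP.
Qed.

Definition cross (r : T -> 'I_h) : {set {set T}} :=
  [set X in copies H G | [forall i, r (emb X i) == i]].

Lemma crossP (r : T -> 'I_h) X :
  reflect (X \in copies H G /\ forall i, r (emb X i) = i) (X \in cross r).
Proof.
rewrite /cross in_set; apply: (iffP andP) => -[XH rX]; split=> //.
  by move=> i; apply/eqP; have /forallP := rX.
by apply/forallP => i; apply/eqP.
Qed.

Lemma card_cross_le (r : T -> 'I_h) (Z : {set T}) :
  #|[set X in cross r | X \subset Z]| <= f #|Z| h.
Proof.
apply: leq_trans (prod_le_f h0 (eq_leq (sum_fibers r Z))).
apply: card_family_le => [|X i].
  by apply/subsetP => X; rewrite in_set => /andP[/crossP[]].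
rewrite in_set => /andP[/crossP[XH rX] /subsetP XZ].
by rewrite in_set rX eqxx XZ ?emb_mem.
Qed.

Lemma cross_prod (r : T -> 'I_h) :
  #|cross r| <= \prod_i #|[set x | r x == i]|.
Proof.
apply: card_family_le => [|X i /crossP[XH rX]]; last by rewrite inE rX.
by apply/subsetP => X /crossP[].
Qed.

(* Among the embeddings agreeing with a most popular one on [Q], a vertex
   outside the image of [Q] plays the role determined by its adjacency to
   that image. *)
Lemma popular_roles (Q : {set 'I_h}) : distinguishing H Q ->
  exists r : T -> 'I_h, #|copies H G| <= n ^ #|Q| * #|cross r|.
Proof.
move=> dQ; pose key X : #|Q|.-tuple T := [tuple emb X (enum_val i) | i < #|Q|].
have [X0 X0H|none] := pickP (mem (copies H G)); last first.
  exists (fun=> Ordinal h0); rewrite (_ : copies H G = set0) ?cards0 //.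
  by apply/setP => X; rewrite [LHS]none inE.
pose F y := [set X in copies H G | key X == y].
pose y0 := [arg max_(y > key X0) #|F y|].
have y0P y : #|F y| <= #|F y0| by rewrite /y0; case: arg_maxnP => // z _; apply.
have keyE X Y i : X \in F y0 -> Y \in F y0 -> i \in Q -> emb X i = emb Y i.
  rewrite !in_set => /andP[_ /eqP EX] /andP[_ /eqP EY] iQ.
  have /(congr1 (fun y => tnth y (enum_rank_in iQ i))) : key X = key Y by rewrite EX.
  by rewrite !tnth_mktuple enum_rankK_in.
have FH X : X \in F y0 -> X \in copies H G by rewrite in_set => /andP[].
(* This makes the role of a vertex well defined. If one vertex plays [i] in [X] and [j] in [Y], then
   all of [Q], having the same image in both copies, is adjacent alike to [i] and [j]. *)
have roleE X Y i j : X \in F y0 -> Y \in F y0 -> emb X i = emb Y j -> i = j.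
  move=> XF YF E; apply: contraTeq isT => ij; exfalso.
  have iQ : i \notin Q.
    apply: contraNN ij => iQ; apply/eqP/(emb_inj (FH _ YF)).
    by rewrite -E; apply/esym/keyE.
  have jQ : j \notin Q.
    apply: contraNN ij => jQ; apply/eqP/(emb_inj (FH _ XF)).
    by rewrite E; apply/esym/keyE.
  have /negP := dQ i j ij iQ jQ; apply; apply/subsetP => q qQ.
  have A : adj H q i = adj H q j.
    by rewrite -(emb_adj (FH _ XF)) E (keyE X Y q) // (emb_adj (FH _ YF)).
  rewrite !inE; apply/andP; split.
    by rewrite negb_or; apply/andP; split; apply: contraTneq qQ => ->.
  case Aq : (adj H q i); apply/orP; [left|right]; apply/forall_inP => z;
    by rewrite !inE => /orP[] /eqP -> //; rewrite -?A Aq.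
pose r x := odflt (Ordinal h0)
  [pick i | [exists X in F y0, emb X i == x]].
exists r; apply: (@leq_trans (n ^ #|Q| * #|F y0|)).
  have -> : n ^ #|Q| = #|{: #|Q|.-tuple T}| by rewrite card_tuple.
  rewrite -sum_nat_const -[X in X <= _]sum1_card.
  rewrite (partition_big key xpredT) //=; apply: leq_sum => y _.
  apply: leq_trans (y0P y); rewrite -sum1_card; apply: eq_leq.
  by apply: eq_bigl => X; rewrite [RHS]in_set.
rewrite leq_mul2l; apply/orP; right; apply/subset_leq_card/subsetP => X XF.
apply/crossP; split=> [|i]; first exact: FH.
rewrite /r; case: pickP => [j /exists_inP[Y YF /eqP E]|/(_ i)].
  by rewrite (roleE Y X j i).
by move/negbT/negP; case; apply/exists_inP; exists X.
Qed.

Lemma pick_elt (X Z : {set T}) : ~~ (X \subset Z) -> exists2 v, v \in ~: Z & v \in X.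
Proof. by case/subsetPn => v vX vZ; exists v; rewrite ?inE. Qed.

(** * Conflicts, rich vertices and regular copies for roles that capture a fraction [n ^ -q] of
    [f n h] *)

Section Roles.
Variables (r : T -> 'I_h) (q A : nat).
Hypothesis rq : f n h <= n ^ q * #|cross r|.
Hypothesis Ah : A <= h.
Hypothesis slackA : n ^ (A * (q + 9)) <= 2 ^ h.

Lemma slack_le (c d : nat) : c * d <= A * (q + 9) -> (n ^ c) ^ d <= 2 ^ h.
Proof.
move=> cd; apply: leq_trans slackA; rewrite -expnM leq_exp2l //.
Qed.

(** These vertices cannot share a copy of [cross r] with [v]. *)
Definition conf (v : T) : {set T} :=
  [set x | (x != v) && ((r x == r v) || (adj G v x != adj H (r v) (r x)))].

Definition through (v : T) : {set {set T}} := [set X in cross r | v \in X].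

(** The exponent [q + 2] is chosen so that all poor vertices together spoil at most a fraction
    [1 / n] of [cross r], while the loss [n ^ (q + 2)] is still affordable in [deficit]. *)
Definition rich : {set T} := [set v | f n h <= n ^ (q + 2) * #|through v|].

Lemma through_le (v : T) : #|through v| <= f (n - #|conf v|) h.
Proof.
have -> : n - #|conf v| = #|~: conf v| by rewrite /n -(cardsC (conf v)) addKn.
apply: leq_trans (card_cross_le r _); apply/subset_leq_card/subsetP => X.
rewrite /through in_set => /andP[/crossP[XH rX] vX].
rewrite in_set; apply/andP; split; first by apply/crossP.
apply/subsetP => x xX; rewrite !inE.
have [i <-] := emb_onto XH xX; have [j <-] := emb_onto XH vX.
rewrite !rX emb_adj // eqxx orbF; apply/nandP.
by have [->|_] := eqVneq i j; [left; rewrite eqxx|right].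
Qed.

Lemma conf_le (v : T) : v \in rich -> A * #|conf v| <= 4 * n.
Proof.
rewrite inE => vr; apply: (@deficit h n A (n ^ (q + 2))) => //.
  by apply: slack_le; rewrite mulnC leq_mul2l; apply/orP; right; lia.
by apply: leq_trans vr _; rewrite leq_mul2l through_le orbT.
Qed.

(** Most copies of [cross r] avoid all poor vertices, so deleting these vertices costs only a factor
    [n ^ (q + 2)], and [deficit] applies. *)
Lemma poor_le : A * #|~: rich| <= 4 * n.
Proof.
apply: (@deficit h n A (n ^ (q + 2))) => //.
  by apply: slack_le; rewrite mulnC leq_mul2l; apply/orP; right; lia.
have -> : n - #|~: rich| = #|rich| by rewrite /n -(cardsC rich) addnK.
have cr := card_cross_le r rich.
set C := [set X in cross r | X \subset rich] in cr.
have split_cross : #|cross r| <= #|C| + \sum_(v in ~: rich) #|through v|.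
  have <- : C :|: (cross r :\: C) = cross r.
    rewrite -[RHS](setID _ C) [RHS]setUC setUC; congr (_ :|: _).
    by apply/esym/setIidPr/subsetP => X; rewrite /C in_set => /andP[].
  apply: leq_trans (leq_card_setU _ _) _; rewrite leq_add2l.
  apply: (@leq_trans #|\bigcup_(v in ~: rich) through v|); last exact: card_bigcup_le.
  apply/subset_leq_card/subsetP => X; rewrite in_setD => /andP[XC Xc].
  move: XC; rewrite /C in_set Xc => /pick_elt[v vr vX].
  by apply/bigcupP; exists v; rewrite // /through in_set Xc.
have poor : n ^ (q + 2) * \sum_(v in ~: rich) #|through v| <= n * f n h.
  rewrite big_distrr /=; apply: (@leq_trans (\sum_(v in ~: rich) f n h)).
    by apply: leq_sum => v; rewrite !inE -ltnNge => /ltnW.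
  by rewrite sum_nat_const leq_mul2r max_card orbT.
have E : n ^ (q + 2) = n ^ q * (n * n) by rewrite expnD.
apply: leq_trans (_ : _ <= n ^ (q + 2) * #|C|) _; last by rewrite leq_mul2l cr orbT.
have : n * n * f n h <= n ^ (q + 2) * #|C| + n * f n h.
  apply: leq_trans (leq_add (leqnn _) poor); rewrite -mulnDr.
  apply: leq_trans (_ : _ <= n ^ (q + 2) * #|cross r|) _.
    by rewrite E (mulnC (n ^ q)) -[X in _ <= X]mulnA leq_mul2l rq orbT.
  by rewrite leq_mul2l split_cross orbT.
suff : f n h + n * f n h <= n * n * f n h by lia.
by rewrite -mulSn leq_mul2r; apply/orP; right; move: n1; nia.
Qed.

Section Regular.
(* A vertex of a copy is bad if it is not rich or has at least [t] conflicts with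
   earlier rich vertices; bad vertices have density at most [1 / M], and a copy is
   regular if it has fewer than [k] of them in some order. *)
Variables (M k t : nat).
Hypotheses (M0 : 0 < M) (MA : 8 * M <= A) (MAt : 8 * M * h <= A * t).
Hypotheses (Mk : 32 ^ h <= M ^ k) (ht : 10 ^ 5 * (2 * t) <= h).
Hypothesis hk : 10 * k <= h.

Definition crowd (s : seq T) : {set T} :=
  [set x | t <= #|[set y in rich | (y \in s) && (x \in conf y)]|].

Definition bad (s : seq T) : {set T} := ~: rich :|: crowd s.

(** Double counting of the conflicts between [crowd s] and the rich entries of [s], each of which
    has at most [4 * n / A] by [conf_le]. *)
Lemma crowd_le (s : seq T) : A * t * #|crowd s| <= 4 * n * size s.
Proof.
pose N x := [set y in rich | (y \in s) && (x \in conf y)].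
have step : #|crowd s| * t <= \sum_(y in rich | y \in s) #|conf y|.
  apply: (@leq_trans (\sum_x #|N x|)).
    rewrite -sum_nat_const [X in _ <= X](bigID (mem (crowd s))) /=.
    apply: leq_trans (leq_addr _ _); apply: leq_sum => x.
    by rewrite /crowd in_set.
  apply: eq_leq; under eq_bigr do rewrite -sum1_card.
  rewrite (exchange_big_dep (fun y => (y \in rich) && (y \in s))) /=.
    apply: eq_bigr => y /andP[yr ys]; rewrite -sum1_card; apply: eq_bigl => x.
    by rewrite /N in_set yr ys.
  by move=> x y _; rewrite /N in_set => /and3P[-> ->].
rewrite -mulnA (mulnC t); apply: leq_trans (leq_mul (leqnn A) step) _.
rewrite big_distrr /=.
apply: (@leq_trans (\sum_(y in rich | y \in s) 4 * n)).
  by apply: leq_sum => y /andP[yr _]; apply: conf_le.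
rewrite sum_nat_const mulnC leq_mul2l; apply/orP; right.
apply: leq_trans (card_size s); apply/subset_leq_card/subsetP => y.
by rewrite unfold_in /= => /andP[].
Qed.

Lemma bad_le (s : seq T) : size s < h -> M * #|bad s| <= n.
Proof.
move=> sh; have A0 : 0 < A by apply: leq_trans MA; rewrite muln_gt0.
have b1 : 2 * M * #|~: rich| <= n.
  rewrite -(leq_pmul2l (isT : 0 < 4)); apply: leq_trans poor_le.
  by rewrite !mulnA leq_mul2r MA orbT.
have b2 : 2 * M * #|crowd s| <= n.
  have h4 : 0 < 4 * h by rewrite muln_gt0.
  rewrite -(leq_pmul2l h4).
  apply: (@leq_trans (A * t * #|crowd s|)).
    have -> : 4 * h * (2 * M * #|crowd s|) = 8 * M * h * #|crowd s| by lia.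
    by rewrite leq_mul2r MAt orbT.
  apply: leq_trans (crowd_le s) _; rewrite [X in _ <= X]mulnAC leq_mul2l.
  by rewrite ltnW ?orbT.
have := leq_card_setU (~: rich) (crowd s); rewrite -/(bad s).
set a := #|_| in b1 *; set b := #|crowd s| in b2 *; set c := #|bad s| => cab.
apply: leq_trans (leq_mul (leqnn M) cab) _; lia.
Qed.

Definition irregular : {set {set T}} :=
  [set X in copies H G | ~~ regular bad h k X].

(** From [n ^ h <= (2h) ^ h * f n h] and [h ^ h <= 4 ^ h * h!] the total weight divided by [h!] is
    at most [16 ^ h * f n h]. The factor [32 ^ h] supplied by [M ^ k] leaves [2 ^ -h], which is at
    most [n ^ -9]. *)
Lemma irregular_le : #|irregular| * n ^ 9 <= f n h.
Proof.
have W := card_irregular k M0 bad_le.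
have I : #|irregular| <=
    #|[set X : {set T} | (#|X| == h) && ~~ regular bad h k X]|.
  apply/subset_leq_card/subsetP => X; rewrite /irregular in_set => /andP[XH XR].
  by rewrite in_set XR andbT (card_copy XH) card_ord.
have n9 : n ^ 9 <= 2 ^ h.
  by rewrite -[n ^ 9]expn1; apply: slack_le; move: MA M0; nia.
set a := #|irregular| in I *; set b := #|_| in W I.
have hf : 0 < h`! := fact_gt0 h.
have {W} W : a * 32 ^ h <= 16 ^ h * f n h.
  rewrite -(leq_pmul2r hf); apply: (@leq_trans (b * h`! * M ^ k)).
    by rewrite mulnAC leq_mul // leq_mul2r I orbT.
  apply: leq_trans W _; rewrite expnMn.
  apply: leq_trans (leq_mul (leqnn _) (expn_le_f h0 hn)) _; rewrite expnMn.
  apply: (@leq_trans (2 ^ h * (2 ^ h * (4 ^ h * h`!) * f n h))).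
    by rewrite leq_mul2l leq_mul2r leq_mul2l expn_le_fact !orbT.
  have -> : 16 ^ h = 2 ^ h * (2 ^ h * 4 ^ h) by rewrite -!expnMn.
  by apply: eq_leq; lia.
have E : 32 ^ h = 16 ^ h * 2 ^ h by rewrite -expnMn.
have p16 : 0 < 16 ^ h by rewrite expn_gt0.
rewrite -(leq_pmul2l p16); apply: leq_trans W.
by rewrite E mulnCA leq_mul2l leq_mul2l n9 !orbT.
Qed.

Definition correct (X : {set T}) : {set 'I_h} := [set i | r (emb X i) == i].

(** At least [h - k] positions are not bad. Each conflicts with fewer than [t] earlier ones among
    them, since those are rich. This gives at most [2 * h * t] ordered conflicts, and the constant
    25 of [rigidity] yields at most [50 * t] misplaced positions. *)
Lemma regular_correct (X : {set T}) : X \in copies H G ->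
  regular bad h k X -> h <= #|correct X| + k + 50 * t.
Proof.
move=> XH /existsP[x /and3P[/allP xX xu xk]].
have Xx y : y \in X -> y \in x.
  have cX := card_copy XH; rewrite card_ord in cX.
  suff -> : X = [set y in x] by rewrite inE.
  apply/eqP; rewrite eq_sym eqEcard cX cardsE (card_uniqP xu) size_tuple leqnn andbT.
  by apply/subsetP => z; rewrite inE => /xX.
have ex i : emb X i \in (x : seq T) by apply/Xx/emb_mem.
pose idx i := index (emb X i) x.
pose isbad i := emb X i \in bad (take (idx i) x).
pose Y := [set i | ~~ isbad i].
have cY : h <= #|Y| + k.
  suff Yk : #|~: Y| <= k by rewrite -[X in X <= _]card_ord -(cardsC Y) leq_add2l.
  apply: leq_trans (ltnW xk); rewrite nbad_count //.
  rewrite -size_filter -(card_imset _ (emb_inj XH)).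
  rewrite (cardE (mem (emb X @: ~: Y))); apply: uniq_leq_size; first exact: enum_uniq.
  move=> y; rewrite mem_enum => /imsetP[i]; rewrite !inE negbK => ib ->.
  by rewrite mem_filter ex andbT.
pose rho i := r (emb X i).
pose e i j := conflict H rho i j && (idx j < idx i).
have eY : pair_count Y e <= h * t.
  rewrite /pair_count -[X in X * t]card_ord.
  apply: (@leq_trans (\sum_(i in Y) t)); last first.
    by rewrite sum_nat_const leq_mul2r max_card orbT.
  apply: leq_sum => i; rewrite inE /isbad /bad in_setU negb_or => /andP[_].
  rewrite /crowd in_set -ltnNge => /ltnW; apply: leq_trans.
  rewrite -(card_imset _ (emb_inj XH)); apply/subset_leq_card/subsetP => y.
  case/imsetP => j; rewrite inE => /andP[jY /andP[/andP[ij cf] ji]] ->.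
  rewrite in_set; apply/and3P; split.
  - move: jY; rewrite inE /isbad /bad in_setU negb_or in_setC negbK.
    by case/andP.
  - by rewrite in_take ?ex.
  rewrite /conf in_set (inj_eq (emb_inj XH)) ij /=.
  by rewrite !emb_adj // [adj H j i]adj_sym [adj H (r _) _]adj_sym.
have cfY : pair_count Y (conflict H rho) <= 2 * (h * t).
  have csym i j : conflict H rho i j = conflict H rho j i.
    by rewrite /conflict /= eq_sym [rho i == _]eq_sym adj_sym [adj H (rho i) _]adj_sym.
  pose e' i j := e j i.
  have E' : pair_count Y e' = pair_count Y e.
    exact: pair_count_swap.
  rewrite mul2n -addnn.
  apply: leq_trans (leq_add eY (leq_trans (eq_leq E') eY)).
  rewrite !pair_countE; apply: leq_trans (leq_card_setU _ _).
  apply/subset_leq_card/subsetP => -[i j]; rewrite !inE /= => /and3P[-> -> cij] /=.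
  rewrite /e' /e (csym j i) cij /=.
  have : idx i != idx j.
    apply: contraTneq cij => E; have /(congr1 (nth (emb X i) x)) := E.
    by rewrite !nth_index // => /(emb_inj XH) ->; rewrite /conflict /= eqxx.
  by case: ltngtP.
have Yh : 9 * h <= 10 * #|Y| by move: cY hk; set a := #|Y|; lia.
have C5 : 10 ^ 5 * pair_count Y (conflict H rho) <= h ^ 2.
  apply: leq_trans (leq_mul (leqnn _) cfY) _.
  by rewrite (mulnC h) 2!mulnA -mulnn leq_mul2r -mulnA ht orbT.
have mis := rigidity sa h200 Yh C5.
have {}mis : #|[set y in Y | rho y != y]| <= 50 * t.
  rewrite -(leq_pmul2r h0); apply: leq_trans mis _.
  by apply: leq_trans (leq_mul (leqnn _) cfY) _; lia.
have YC : #|Y| <= #|correct X| + #|[set y in Y | rho y != y]|.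
  apply: leq_trans (leq_card_setU _ _); apply/subset_leq_card/subsetP => i iY.
  by rewrite in_setU in_set /rho in_set iY; case: eqP.
move: cY YC mis; set a := #|Y|; set b := #|correct X|; set c := #|_|; lia.
Qed.
End Regular.

(** * The roles that a vertex fits *)

Definition mism (i : 'I_h) (v : T) : {set T} :=
  [set x | (r x != i) && (adj G v x != adj H i (r x))].

(** [128 = 2 * 64]: in [fit_uniq] two mismatch sets, inflated 64-fold, must add at most [n] to the
    total size. *)
Definition fit (i : 'I_h) (v : T) : bool := 128 * #|mism i v| <= n.

(* If [v] fits two roles [i] and [j], then the parts of the many vertices of
   [H] telling [i] and [j] apart are covered by two small sets. Inflating these
   parts 64-fold would increase the product of the part sizes too much. *)
Lemma fit_uniq (i j : 'I_h) (v : T) : 10 <= A -> fit i v -> fit j v -> i = j.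
Proof.
move=> A10 fi fj; apply: contraTeq isT => ij; exfalso.
pose D := [set l | [&& l != i, l != j & adj H i l != adj H j l]].
have hD : 4 * h <= 10 * #|D|.
  have cov : h <= 2 + #|agreement H [set i; j]| + #|D|.
    have -> : 2 = #|[set i; j]| by rewrite cards2 ij.
    apply: leq_trans (leq_trans (leq_card_setU _ _)
      (leq_add (leq_card_setU _ _) (leqnn #|D|))).
    rewrite -[X in X <= _]card_ord -cardsT; apply/subset_leq_card/subsetP => l _.
    rewrite !inE; have [//|li] := eqVneq l i; have [//|lj] := eqVneq l j.
    rewrite /=; case: (eqVneq (adj H i l) (adj H j l)) => [E|]; last by rewrite orbT.
    rewrite orbF; case Al : (adj H i l); apply/orP; [left|right];
      apply/forall_inP => z; rewrite !inE => /orP[] /eqP ->;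
      by rewrite adj_sym -?E Al.
  have := asym_agreement sa ij; move: cov.
  set a := #|agreement _ _|; set d := #|D|; lia.
pose P l := [set x | r x == l].
pose U := mism i v :|: mism j v.
pose b l := (if l \in D then 64 else 1) * #|P l|.
have sumP : \sum_l #|P l| = n.
  rewrite /n -cardsT -(sum_fibers r); apply: eq_bigr => l _.
  by apply: eq_card => x; rewrite !inE.
have PU l : l \in D -> P l = [set x in U | r x == l].
  rewrite inE => /and3P[li lj Hij]; apply/setP => x; rewrite !inE.
  case: eqP => [->|]; rewrite ?andbF // li lj /= andbT.
  by move: Hij; case: (adj G v x); case: (adj H i l); case: (adj H j l).
have sumD : \sum_(l in D) #|P l| <= #|U|.
  rewrite -(sum_fibers r U) [X in _ <= X](bigID (mem D)) /=.
  by apply: leq_trans (leq_addr _ _); apply: leq_sum => l /PU ->.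
have sumb : \sum_l b l <= 2 * n.
  apply: (@leq_trans (64 * #|U| + n)).
    rewrite -sumP [X in _ <= _ + X](bigID (mem D)) [X in X <= _](bigID (mem D)) /=.
    rewrite addnA; apply: leq_add; last first.
      by apply: leq_sum => l /negbTE lD; rewrite /b lD mul1n.
    apply: leq_trans (leq_addr _ _); apply: leq_trans (leq_mul (leqnn 64) sumD).
    by rewrite big_distrr /=; apply: leq_sum => l lD; rewrite /b lD.
  have : #|U| <= #|mism i v| + #|mism j v| by apply: leq_card_setU.
  move: fi fj; rewrite /fit; set x := #|mism i v|; set y := #|mism j v|; set z := #|U|.
  lia.
have prodb : \prod_l b l = 64 ^ #|D| * \prod_l #|P l|.
  by rewrite big_split /= -big_mkcond /= prod_nat_const.
have f0 : 0 < f n h := f_gt0 h0 hn.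
(* The left side is at least [2 ^ (2.4h)] as [#|D| >= 0.4h], the right side at most [2 ^ (2.1h)].
   Tenth powers below avoid the fractions. *)
have key : 64 ^ #|D| <= n ^ q * 4 ^ h.
  rewrite -(leq_pmul2r f0).
  apply: leq_trans (leq_mul (leqnn _) rq) _.
  have bf : 64 ^ #|D| * #|cross r| <= 4 ^ h * f n h.
    apply: leq_trans (f_double h0 hn); apply: leq_trans (prod_le_f h0 sumb).
    by rewrite prodb leq_mul2l cross_prod orbT.
  by rewrite mulnCA -mulnA leq_mul2l bf orbT.
have : (64 ^ #|D|) ^ 10 <= (n ^ q * 4 ^ h) ^ 10 by rewrite leq_exp2r.
have q10 : (n ^ q) ^ 10 <= 2 ^ h.
  by apply: slack_le; rewrite mulnC leq_mul //; lia.
rewrite leqNgt => /negP; apply; rewrite expnMn.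
apply: leq_ltn_trans (leq_mul q10 (leqnn _)) _.
rewrite -(expnM 4) (_ : 4 = 2 ^ 2) // -expnM -expnD.
rewrite -(expnM 64) (_ : 64 = 2 ^ 6) // -expnM ltn_exp2l //.
move: hD h0; set d := #|D|; lia.
Qed.

Section NonFit.
Variable ee : nat.
Hypotheses (he : h <= 2 ^ 17 * ee) (eh : 30 * (2050 * ee) <= h).
Hypothesis A2050 : 2050 <= A.

Let ee0 : 0 < ee.
Proof. by rewrite lt0n; apply: contraTneq he => ->; rewrite muln0 -ltnNge. Qed.

(** In a copy with [v] at position [i], the vertices at correct positions other than [i] avoid
    [mism i v], which has more than [n / 128] elements. Such a loss in the product outweighs the
    freedom at the [ee] other positions. *)
Lemma nonfit_le (i : 'I_h) (v : T) : ~~ fit i v ->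
  #|[set X in copies H G | (h < #|correct X| + ee) && (emb X i == v)]| * n ^ 9
    <= f n h.
Proof.
move=> nf; set C := [set X in _ | _].
have f0 : 0 < f n h := f_gt0 h0 hn.
have eeh : 256 * ee <= h by lia.
(* The [ee] positions missing from the product are given dummy parts of size [s]. These use up at
   most [n / 256] of the vertices lost, so [x] is what remains of the loss. *)
pose m := #|mism i v|; pose s := n %/ 256 %/ ee; pose x := m - n %/ 256.
have m128 : n < 128 * m by rewrite ltnNge.
have s0 : 0 < s by rewrite /s !divn_gt0 // leq_divRL //; apply: leq_trans hn; lia.
have ns : n <= 512 * ee * s.
  have s1 : n %/ 256 < s.+1 * ee by rewrite -ltn_divLR.
  have s2 : n < (n %/ 256).+1 * 256 by rewrite -ltn_divLR.
  have : s.+1 * ee <= 2 * s * ee by rewrite leq_mul2r; apply/orP; right; lia.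
  by move: s1 s2; set u := n %/ 256; lia.
pose P (D : {set 'I_h}) j :=
  if j \in D then [set y | (r y == j) && (y \notin mism i v)] else [set v].
have prodP (D : {set 'I_h}) : #|D| = h - ee ->
    (\prod_j #|P D j|) * s ^ ee <= f (n - x) h.
  move=> cD; pose b j := if j \in D then #|P D j| else s.
  have cD' : #|[predC D]| = ee.
    by have := cardC (mem D); rewrite cD card_ord; move: eeh; set a := #|_|; lia.
  have -> : (\prod_j #|P D j|) * s ^ ee = \prod_j b j.
    rewrite (bigID (mem D)) [in RHS](bigID (mem D)) /=.
    rewrite [X in _ * X * _]big1 => [|j /negbTE jD]; last by rewrite /P jD cards1.
    rewrite muln1; congr (_ * _); first by apply: eq_bigr => j jD; rewrite /b jD.
    rewrite (eq_bigr (fun=> s)) => [|j /negbTE jD]; last by rewrite /b jD.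
    by rewrite prod_nat_const -cD'.
  apply: prod_le_f => //; rewrite (bigID (mem D)) /=.
  have D1 : \sum_(j in D) b j <= n - m.
    have -> : n - m = #|~: mism i v| by rewrite /n -(cardsC (mism i v)) addKn.
    rewrite -(sum_fibers r) [X in _ <= X](bigID (mem D)) /=.
    apply: leq_trans (leq_addr _ _); apply: leq_sum => j jD; rewrite /b /P jD.
    by apply/subset_leq_card/subsetP => y; rewrite !inE andbC.
  have D2 : \sum_(j | j \notin D) b j <= n %/ 256.
    rewrite (eq_bigr (fun=> s)) => [|j /negbTE jD]; last by rewrite /b jD.
    by rewrite sum_nat_const -[#|_|]/#|[predC D]| cD' mulnC leq_trunc_div.
  apply: leq_trans (leq_add D1 D2) _.
  have mn : m <= n by apply: max_card.
  by rewrite /x; move: m128 mn; clear; set u := n; lia.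
pose DD := [set D : {set 'I_h} | #|D| == h - ee].
pose CD (D : {set 'I_h}) := [set X in C | (D \subset correct X) && (i \notin D)].
have cov : #|C| <= \sum_(D in DD) #|CD D|.
  apply: leq_trans (card_bigcup_le _ _); apply/subset_leq_card/subsetP => X XC.
  have big : h < #|correct X| + ee.
    by move: XC; rewrite /C in_set => /and3P[].
  have : h - ee <= #|correct X :\ i|.
    have := cardsD1 i (correct X); move: big; set a := #|correct X|.
    by set b := #|_ :\ _|; case: (i \in _) => /=; lia.
  case/subset_of_card => D /subsetP DS cD; apply/bigcupP; exists D.
    by rewrite /DD in_set cD.
  rewrite /CD in_set XC /=; apply/andP; split.
    by apply/subsetP => j /DS; rewrite in_setD1 => /andP[].
  by apply/negP => /DS; rewrite in_setD1 eqxx.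
(* A copy is recovered from its embedding on [D] and the unordered set of its other [ee] vertices.
   Leaving these unordered matters: ['C(n, ee)] is comparable to [s ^ ee] up to a factor exponential
   in [ee], whereas [n ^ ee] is not. *)
have CDle D : D \in DD -> #|CD D| <= (\prod_j #|P D j|) * 'C(n, ee).
  rewrite /DD in_set => /eqP cD.
  pose F := [set p : {ffun 'I_h -> T} in family (P D)].
  have -> : \prod_j #|P D j| = #|F|.
    by rewrite cardsE card_family foldrE big_map big_enum.
  rewrite /n -card_draws -cardsX.
  pose g X : {ffun 'I_h -> T} := [ffun j => if j \in D then emb X j else v].
  have CDH X : X \in CD D -> [/\ X \in copies H G, emb X i = v,
      forall j, j \in D -> r (emb X j) = j & i \notin D].
    rewrite /CD in_set /C in_set => /and3P[/and3P[XH _ /eqP Xi] /subsetP DX iD].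
    by split=> // j /DX; rewrite /correct in_set => /eqP.
  have imE X : X \in CD D -> g X @: D = emb X @: D.
    by move=> _; apply: eq_in_imset => j jD; rewrite ffunE jD.
  have imX X : X \in CD D -> emb X @: D \subset X.
    by case/CDH => XH _ _ _; rewrite -{2}(emb_im XH) imsetS // subsetT.
  have inj : {in CD D &, injective (fun X => (g X, X :\: emb X @: D))}.
    move=> X Y XC YC [Eg]; rewrite -!imE // Eg => ER.
    have XE : X = g X @: D :|: (X :\: g X @: D).
      by rewrite (imE _ XC); have /setIidPr E := imX _ XC;
        rewrite -{1}(setID X (emb X @: D)) E.
    have YE : Y = g Y @: D :|: (Y :\: g Y @: D).
      by rewrite (imE _ YC); have /setIidPr E := imX _ YC;
        rewrite -{1}(setID Y (emb Y @: D)) E.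
    by rewrite XE YE Eg ER.
  rewrite -(card_in_imset inj); apply/subset_leq_card/subsetP => p.
  case/imsetP => X XC ->; have [XH Xi XD iD] := CDH _ XC.
  rewrite inE /=; apply/andP; split.
    rewrite /F in_set; apply/familyP => j; rewrite ffunE /P; case: ifP => jD.
      rewrite in_set XD // eqxx /= /mism in_set negb_and negbK; apply/orP; right.
      by rewrite negbK -Xi emb_adj // XD.
    by rewrite in_set1.
  rewrite in_set cardsD (setIidPr (imX _ XC)) (card_imset _ (emb_inj XH)).
  by rewrite (card_copy XH) card_ord cD subKn //; lia.
have Cs : #|C| * s ^ ee <= 'C(h, ee) * 'C(n, ee) * f (n - x) h.
  apply: leq_trans (leq_mul cov (leqnn _)) _; rewrite big_distrl /=.
  apply: (@leq_trans (\sum_(D in DD) 'C(n, ee) * f (n - x) h)).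
    apply: leq_sum => D DDD; apply: leq_trans (leq_mul (CDle _ DDD) (leqnn _)) _.
    rewrite mulnAC mulnC leq_mul2l; apply/orP; right; apply: prodP.
    by move: DDD; rewrite /DD in_set => /eqP.
  rewrite sum_nat_const mulnA /DD card_draws card_ord bin_sub //; lia.
have bins : 'C(h, ee) * 'C(n, ee) <= 2 ^ (30 * ee) * s ^ ee.
  have e2 : 0 < (ee * ee) ^ ee by rewrite expn_gt0 muln_gt0 ee0.
  rewrite -(leq_pmul2r e2) expnMn mulnACA.
  apply: leq_trans (leq_mul (bin_le_div _ _) (bin_le_div _ _)) _.
  rewrite expnM -!expnMn leq_exp2r //.
  have -> : 2 ^ 30 = 2 ^ 17 * 2 ^ 13 by rewrite -expnD.
  have -> : 2 ^ 13 = 4 * 4 * 512 by [].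
  apply: leq_trans (_ : _ <= 4 * (2 ^ 17 * ee) * (4 * (512 * ee * s))) _.
    by apply: leq_mul; rewrite leq_mul2l ?he ?ns.
  by apply: eq_leq; move: (2 ^ 17) => u; clear; lia.
have CF : #|C| <= 2 ^ (30 * ee) * f (n - x) h.
  have se : 0 < s ^ ee by rewrite expn_gt0 s0.
  rewrite -(leq_pmul2r se); apply: leq_trans Cs _.
  by apply: leq_trans (leq_mul bins (leqnn _)) _; rewrite mulnAC.
rewrite leqNgt; apply/negP => big.
have F2050 : (n ^ 9 * 2 ^ (30 * ee)) ^ 2050 <= 2 ^ h * 2 ^ h.
  rewrite expnMn leq_mul //; last by rewrite -expnM leq_exp2l // mulnAC -mulnA.
  by apply: slack_le; rewrite mulnC leq_mul // addnC leq_addr.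
(* [deficit] gives [1025 * x <= 4 * n], hence [x] below [n / 256], which contradicts [m > n / 128].
   The exponent 2050 is twice 1025, because [n ^ 9] and [2 ^ (30 * ee)] each take up a factor
   [2 ^ h]. *)
have [B EB] : exists B, B = 1025 by exists 1025.
have FB : (n ^ 9 * 2 ^ (30 * ee)) ^ B <= 2 ^ h.
  rewrite -(@leq_exp2r _ _ 2) // -expnM.
  have -> : B * 2 = 2050 by rewrite EB.
  by apply: leq_trans F2050 _; rewrite mulnn.
have Bh : B <= h by rewrite EB; move: eh ee0; clear; lia.
have Fx : f n h <= n ^ 9 * 2 ^ (30 * ee) * f (n - x) h.
  apply: leq_trans (ltnW big) _; rewrite mulnC -mulnA leq_mul2l.
  by rewrite CF orbT.
have := deficit h0 hn Bh FB Fx.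
by rewrite EB /x; move: m128; clear; set u := n; lia.
Qed.
End NonFit.
End Roles.

(** * The final roles, and exactness of the blowup *)

Section Structure.
Variables (A M k t ee : nat) (Q : {set 'I_h}).
Hypotheses (A2050 : 2050 <= A) (Ah : A <= h).
Hypotheses (M0 : 0 < M) (MA : 8 * M <= A) (MAt : 8 * M * h <= A * t).
Hypotheses (Mk : 32 ^ h <= M ^ k) (ht : 10 ^ 5 * (2 * t) <= h).
Hypotheses (hk : 10 * k <= h) (kte : k + 50 * t < ee).
Hypotheses (he : h <= 2 ^ 17 * ee) (eh : 30 * (2050 * ee) <= h).
Hypotheses (dQ : distinguishing H Q) (slackQ : n ^ (A * (#|Q| + 9)) <= 2 ^ h).
Hypothesis many : f n h <= #|copies H G|.
Hypothesis many_through :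
  forall v, f n h <= 2 * n * #|[set X in copies H G | v \in X]|.

Let f0 : 0 < f n h. Proof. exact: f_gt0. Qed.

(** Let [w v] be the unique role that [v] fits. A copy outside [cross w] is irregular or has a
    vertex in a position that it does not fit; each of the [h * n] pairs of position and vertex
    accounts for at most a fraction [n ^ -9]. *)
Lemma stable_roles : exists w : T -> 'I_h,
  f n h * n ^ 9 <= #|cross w| * n ^ 9 + 2 * n ^ 2 * f n h.
Proof.
have [r rQ] := popular_roles dQ.
have rq : f n h <= n ^ #|Q| * #|cross r| := leq_trans many rQ.
pose Irr := irregular r #|Q| k t.
have irr : #|Irr| * n ^ 9 <= f n h.
  exact: (irregular_le rq Ah slackQ M0 MA MAt Mk ht hk).
pose Ex i v := [set X in copies H G | (h < #|correct r X| + ee) && (emb X i == v)].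
have exle i v : ~~ fit r i v -> #|Ex i v| * n ^ 9 <= f n h.
  exact: (nonfit_le rq Ah slackQ he eh A2050).
have good X : X \in copies H G -> X \notin Irr -> h < #|correct r X| + ee.
  move=> XH XI; have XR : regular (bad r #|Q| t) h k X.
    by move: XI; rewrite /Irr /irregular in_set XH negbK.
  have := regular_correct rq Ah slackQ M0 MA MAt Mk ht hk XH XR.
  by move: kte; set a := #|_|; lia.
have n9 : 0 < n ^ 9 by rewrite expn_gt0 ltnW.
have hn' : h <= n := hn.
(* Otherwise the copies through [v] would number at most [(h + 1) * f n h / n ^ 9], fewer than the
   [f n h / (2n)] given by [many_through]. *)
have has_fit v : exists i, fit r i v.
  apply: contrapT => no.
  have nofit i : ~~ fit r i v by apply/negP => fi; apply: no; exists i.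
  have cov : #|[set X in copies H G | v \in X]| <= #|Irr| + \sum_i #|Ex i v|.
    apply: leq_trans (leq_add (leqnn _) (card_bigcup_le _ _)).
    apply: leq_trans (leq_card_setU _ _); apply/subset_leq_card/subsetP => X.
    rewrite in_set => /andP[XH vX]; rewrite in_setU; apply/orP.
    have [XI|XI] := boolP (X \in Irr); [by left | right].
    have [i Xi] := emb_onto XH vX; apply/bigcupP; exists i => //.
    by rewrite /Ex in_set XH good //= Xi eqxx.
  have {}cov : #|[set X in copies H G | v \in X]| * n ^ 9 <= h.+1 * f n h.
    apply: leq_trans (leq_mul cov (leqnn _)) _.
    rewrite mulnDl mulSn leq_add // big_distrl /= -[X in X * _]card_ord -sum_nat_const.
    by apply: leq_sum => i _; apply: exle.
  have : f n h * n ^ 9 <= 2 * n * (h.+1 * f n h).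
    apply: leq_trans (leq_mul (many_through v) (leqnn _)) _.
    by rewrite -mulnA leq_mul2l cov orbT.
  rewrite mulnA mulnC leq_pmul2r // leqNgt => /negP; apply.
  apply: (@leq_trans (n ^ 4)); last by rewrite leq_pexp2l // ltnW.
  rewrite !expnS expn0 muln1; apply: (@leq_ltn_trans (2 * n * n.+1)).
    by rewrite leq_mul2l ltnS hn' orbT.
  by move: n1 h200 hn'; clear; set u := n => *; nia.
pose w v := xchoose (has_fit v).
have wP v : fit r (w v) v := xchooseP (has_fit v).
exists w.
have cov : #|copies H G| <=
    #|cross w| + (#|Irr| + \sum_(p | ~~ fit r p.1 p.2) #|Ex p.1 p.2|).
  apply: leq_trans (leq_add (leqnn _) (leq_add (leqnn _) (card_bigcup_le _ _))).
  apply: leq_trans (leq_add (leqnn _) (leq_card_setU _ _)).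
  apply: leq_trans (leq_card_setU _ _); apply/subset_leq_card/subsetP => X XH.
  rewrite in_setU; have [//|Xw] := boolP (X \in cross w).
  rewrite in_setU; have [//|XI] := boolP (X \in Irr).
  have [i wi] : exists i, w (emb X i) != i.
    apply: contrapT => no; move/crossP: Xw; apply; split=> // i.
    by apply/eqP; apply: contrapT => /negP wi; apply: no; exists i.
  apply/bigcupP; exists (i, emb X i) => /=.
    apply: contraNN wi => fi; apply/eqP.
    have A10 : 10 <= A by apply: leq_trans A2050.
    exact: (fit_uniq rq Ah slackQ A10 (wP _) fi).
  by rewrite /Ex in_set XH good //= eqxx.
apply: leq_trans (leq_mul many (leqnn _)) _.
apply: leq_trans (leq_mul cov (leqnn _)) _.
rewrite mulnDl leq_add2l mulnDl.
have exs : (\sum_(p | ~~ fit r p.1 p.2) #|Ex p.1 p.2|) * n ^ 9 <= h * n * f n h.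
  rewrite big_distrl /=.
  apply: (@leq_trans (\sum_(p : 'I_h * T | ~~ fit r p.1 p.2) f n h)).
    by apply: leq_sum => p; apply: exle.
  rewrite sum_nat_const leq_mul2r; apply/orP; right; apply: leq_trans (max_card _) _.
  by rewrite card_prod card_ord.
apply: leq_trans (leq_add irr exs) _.
rewrite -mulSn leq_mul2r; apply/orP; right.
apply: (@leq_trans (1 + n * n)); first by rewrite add1n ltnS leq_mul2r hn' orbT.
by rewrite -mulnn; move: n1; clear; set u := n; nia.
Qed.

Lemma stable_gap (c : nat) : f n h * n ^ 9 <= c * n ^ 9 + 2 * n ^ 2 * f n h ->
  c * (n ^ 2).+1 <= f n h * n ^ 2 -> False.
Proof.
move=> U L.
have n9 : 0 < n ^ 9 by rewrite expn_gt0 ltnW.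
have n2 : 4 <= n ^ 2 by rewrite (@leq_exp2r 2 n 2).
have : f n h * n ^ 9 * (n ^ 2).+1 <=
    f n h * n ^ 2 * n ^ 9 + 2 * n ^ 2 * f n h * (n ^ 2).+1.
  apply: leq_trans (leq_mul U (leqnn _)) _; rewrite mulnDl leq_add2r.
  by rewrite mulnAC leq_mul2r L orbT.
have -> : n ^ 9 = n ^ 2 * n ^ 2 * (n ^ 2 * n ^ 2 * n).
  by rewrite -!expnD -expnSr -expnD.
move: (n ^ 2) n2 f0 n1; set u := n; move: (f _ _); clear => F z z4 F0 u1 B.
have : F * (z * z * (z * z * u)) <= F * (2 * z * z.+1) by nia.
rewrite leq_pmul2l // leqNgt => /negP; apply.
have : 2 * z * z.+1 < z * z * 4 by nia.
by move=> /leq_trans; apply; rewrite leq_mul2l; apply/orP; right; nia.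
Qed.

(** Either defect, in the parts [i] and [j], gives [#|cross w| + rest i j <= f n h]. As
    [#|cross w| <= n ^ 2 * rest i j], a proportion [1 / (n ^ 2 + 1)] is lost, which [stable_gap]
    excludes. *)
Lemma blowup_structure : exists w : T -> 'I_h, exact_roles H G w /\
  forall i j, #|[set x | w x == i]| <= #|[set x | w x == j]|.+1.
Proof.
have [w wC] := stable_roles; exists w.
pose P i := [set x | w x == i]; pose a i := #|P i|.
have suma : \sum_i a i = n.
  rewrite /n -cardsT -(sum_fibers w); apply: eq_bigr => l _.
  by apply: eq_card => x; rewrite !inE.
have an i : a i <= n by apply: max_card.
pose rest i j := \prod_(l | (l != i) && (l != j)) a l.
have prodE i j (b : 'I_h -> nat) : i != j ->
    \prod_l b l = b i * b j * \prod_(l | (l != i) && (l != j)) b l.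
  move=> ij; rewrite (bigD1 i) //= (bigD1 j) /= ?mulnA 1?eq_sym //.
have cw : #|cross w| <= \prod_l a l := cross_prod w.
have gap := stable_gap wC.
split=> [u v uv|i j]; last first.
  rewrite leqNgt; apply/negP => aij.
  have ij : i != j by apply: contraTneq aij => ->; rewrite ltnNge leqnSn.
  (* Moving one vertex from part [i] to part [j] raises the product by at least [rest i j], since
     [a i >= a j + 2]. *)
  pose b l := if l == i then (a i).-1 else if l == j then (a j).+1 else a l.
  have eb l : (l != i) && (l != j) -> b l = a l.
    by rewrite /b => /andP[/negbTE -> /negbTE ->].
  have sumE (c : 'I_h -> nat) :
      \sum_l c l = c i + c j + \sum_(l | (l != i) && (l != j)) c l.
    by rewrite (bigD1 i) //= (bigD1 j) /= ?addnA 1?eq_sym.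
  have sumb : \sum_l b l <= n.
    rewrite -suma !sumE (eq_bigr a) => [|l /eb //].
    rewrite leq_add2r /b eqxx eq_sym (negbTE ij) eqxx.
    by move: aij; rewrite -/(a i) -/(a j); lia.
  have := prod_le_f h0 sumb; rewrite (prodE i j) // (eq_bigr a) => [|l /eb //].
  rewrite -/(rest i j) {1 2}/b eqxx eq_sym (negbTE ij) eqxx => bf.
  apply: gap; move: cw bf; rewrite (prodE i j) // -/(rest i j) => cw bf.
  have {}bf : a i * a j * rest i j + rest i j <= f n h.
    apply: leq_trans bf; rewrite -mulSnr leq_mul2r; apply/orP; right.
    by move: aij; rewrite -/(a i) -/(a j); clear; nia.
  have aa : a i * a j * rest i j <= n ^ 2 * rest i j.
    by rewrite leq_mul2r -mulnn leq_mul ?orbT.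
  apply: leq_trans (leq_mul cw (leqnn _)) _; rewrite mulnS addnC.
  apply: leq_trans (leq_add (leqnn _) aa) _.
  by rewrite (mulnC (n ^ 2) (rest i j)) -mulnDl leq_mul2r bf orbT.
apply/eqP; apply: contrapT => /negP A'; apply: gap.
set i := w u in uv A'; set j := w v in uv A'.
(* No copy of [cross w] contains both [u] and [v]. The split by [v] gives the coefficient [a i * (a
   j - 1) + (a i - 1) = a i * a j - 1] of [rest i j]. *)
pose W1 := [set X in cross w | v \notin X].
pose W2 := [set X in cross w | v \in X].
have W1le : #|W1| <= a i * (a j).-1 * rest i j.
  apply: leq_trans (@card_family_le W1 (fun l => P l :\ v) _ _) _.
  - by apply/subsetP => X; rewrite /W1 in_set => /andP[/crossP[]].
  - move=> X l; rewrite /W1 in_set => /andP[/crossP[XH wX] vX].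
    rewrite in_setD1 in_set wX eqxx andbT; apply: contraNneq vX => <-.
    exact: emb_mem.
  rewrite (prodE i j) //; apply: leq_mul.
    apply: leq_mul; first by rewrite subset_leq_card // subD1set.
    by rewrite /a (cardsD1 v (P j)) in_set eqxx.
  by apply: leq_prod => l _; rewrite subset_leq_card // subD1set.
have W2le : #|W2| <= (a i).-1 * rest i j.
  apply: leq_trans (@card_family_le W2
    (fun l => if l == j then [set v] else P l :\ u) _ _) _.
  - by apply/subsetP => X; rewrite /W2 in_set => /andP[/crossP[]].
  - move=> X l; rewrite /W2 in_set => /andP[/crossP[XH wX] vX].
    have [l' vE] := emb_onto XH vX.
    have lj : l' = j by rewrite -(wX l') vE.
    case: eqP => [->|/eqP jl]; first by rewrite -lj vE in_set1.
    rewrite in_setD1 in_set wX eqxx andbT; apply: contraNneq A' => uE.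
    have li : l = i by rewrite -(wX l) uE.
    by rewrite -uE -vE emb_adj // li lj.
  rewrite (prodE i j) // eqxx (negbTE uv) cards1 muln1; apply: leq_mul.
    by rewrite /a (cardsD1 u (P i)) in_set eqxx.
  apply: leq_prod => l /andP[_ /negbTE ->].
  by rewrite subset_leq_card // subD1set.
have ai : 0 < a i by apply/card_gt0P; exists u; rewrite in_set.
have aj : 0 < a j by apply/card_gt0P; exists v; rewrite in_set.
have W12 : #|cross w| <= #|W1| + #|W2|.
  apply: leq_trans (leq_card_setU _ _); apply/subset_leq_card/subsetP => X XW.
  by rewrite in_setU /W1 in_set XW /W2 in_set XW /=; case: (v \in X).
have cwr : #|cross w| + rest i j <= a i * a j * rest i j.
  apply: leq_trans (leq_add (leq_trans W12 (leq_add W1le W2le)) (leqnn _)) _.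
  rewrite -addnA -mulSnr prednK // -mulnDl leq_mul2r; apply/orP; right.
  by move: ai aj; clear; set x := a i; set y := a j; nia.
have pf : a i * a j * rest i j <= f n h.
  by rewrite -(prodE i j a) // prod_le_f // suma.
have cr : #|cross w| <= n ^ 2 * rest i j.
  apply: leq_trans cw _; rewrite (prodE i j) // leq_mul2r.
  by rewrite -mulnn leq_mul ?orbT.
rewrite mulnS addnC; apply: leq_trans (leq_add (leqnn _) cr) _.
rewrite (mulnC (n ^ 2) (rest i j)) -mulnDl leq_mul2r; apply/orP; right.
exact: leq_trans cwr pf.
Qed.
End Structure.
End Stability.

(** * Nested blowups *)

(** [k], [t] and [ee] are fixed small multiples of [h], each within a factor 2 after rounding down;
    [M], and then [A], is taken large afterwards. *)
Lemma constants : exists A, 2050 <= A /\ forall h, A <= h ->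
  exists M k t ee, [/\ [/\ 0 < M, 8 * M <= A & 8 * M * h <= A * t],
    [/\ 32 ^ h <= M ^ k, 10 ^ 5 * (2 * t) <= h, 10 * k <= h & k + 50 * t < ee],
    h <= 2 ^ 17 * ee & 30 * (2050 * ee) <= h].
Proof.
(* [2 ^ 16] exceeds [30 * 2050], and [2 * c = 2 ^ 17]. The value is hidden behind an equation so
   that the powers stay symbolic. *)
have [c Ec] : exists c, c = 2 ^ 16 by exists (2 ^ 16).
have c16 : 30 * 2050 <= c by rewrite Ec; lia.
have [M [EM M0]] : exists M, M = 2 ^ (5 * (16 * c)) /\ 0 < M.
  by exists (2 ^ (5 * (16 * c))); rewrite expn_gt0.
exists (8 * M * (512 * c)); split; first by move: M0 c16; clear; nia.
move=> h Mh; have ch : 256 * c <= h.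
  by apply: leq_trans Mh; move: M0 c16; clear; nia.
have c0 : 0 < c by lia.
(* The margin is [1/8 + 50/256 = 82/256 < 1/2], the 1/2 allowing for the rounding of [ee]. Also
   [k >= h / (16c)] gives [M ^ k >= 2 ^ (5h)]. *)
exists M, (h %/ (8 * c)), (h %/ (256 * c)), (h %/ c).
have D (d : nat) : 0 < d -> d <= h -> [/\ d * (h %/ d) <= h & h <= 2 * d * (h %/ d)].
  move=> d0 dh; have := divn_eq h d; have := ltn_pmod h d0.
  by have : 0 < h %/ d; [rewrite divn_gt0 | nia].
have [k1 k2] := D (8 * c) ltac:(lia) ltac:(lia).
have [t1 t2] := D (256 * c) ltac:(lia) ltac:(lia).
have [e1 e2] := D c c0 ltac:(lia).
have kte : h %/ (8 * c) + 50 * (h %/ (256 * c)) < h %/ c.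
  have : 256 * (h %/ (8 * c) + 50 * (h %/ (256 * c))) * c <= 82 * h.
    by move: k1 t1; clear; nia.
  by move: e2 c0 ch; clear; nia.
split.
- split=> //; first by rewrite leq_pmulr //; lia.
  rewrite -(mulnA (8 * M)) leq_mul2l; apply/orP; right.
  by apply: leq_trans t2 _; apply: eq_leq; lia.
- split=> //.
  + rewrite EM (_ : 32 = 2 ^ 5) // -!expnM leq_exp2l //; first by move: k2; clear; nia.
  + apply: leq_trans t1; rewrite mulnA leq_mul2r; apply/orP; right.
    by rewrite Ec; lia.
  + by apply: leq_trans k1; rewrite leq_mul2r; apply/orP; right; lia.
- by rewrite (expnSr 2 16) -Ec [c * 2]mulnC.
- by apply: leq_trans e1; rewrite mulnA leq_mul2r c16 orbT.
Qed.

Lemma ind_copies_bin (h n : nat) (H : graph 'I_h) (G : graph 'I_n) :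
  ind_copies H G <= 'C(n, h).
Proof.
rewrite ind_copiesE -[X in 'C(X, h)]card_ord -card_draws.
apply/subset_leq_card/subsetP => X XH.
by rewrite in_set (card_copy XH) card_ord.
Qed.

Lemma max_ind_copies_bin (h n : nat) (H : graph 'I_h) :
  max_ind_copies H n <= 'C(n, h).
Proof. by apply/bigmax_leqP => G _; apply: ind_copies_bin. Qed.

(** Copies avoiding [v] lie in a graph on [n - 1] vertices, so by induction they number at most
    [f (n - 1) h] plus the contribution of the parts. The first term is at most
    [(1 - 1 / n) * f n h], the second at most [f n h / (2n)]. *)
Lemma copies_through (h : nat) (H : graph 'I_h) (T : finType) (G : graph T) :
  64 <= h -> h <= #|T| -> #|T| <= 2 ^ h ->
  (forall m, m < #|T| -> max_ind_copies H m = g m h) ->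
  f #|T| h <= #|copies H G| ->
  forall v, f #|T| h <= 2 * #|T| * #|[set X in copies H G | v \in X]|.
Proof.
move=> h64 hn n2 IH many v; set n := #|T| in hn n2 IH many *.
have h0 : 0 < h by lia.
have n0 : 0 < n by lia.
pose m := n.-1; have En : n = m.+1 by rewrite prednK.
have f0 := f_gt0 h0 hn.
(* With [q = n %/ h], a part has at most [2q] vertices, hence at most [(8q / h) ^ h] copies, while
   [f n h >= q ^ h]. The bound [64 <= h] turns [8 / h] into [1 / 8]. *)
have gle (i : 'I_h) : g (eqpart m i) h * 8 ^ h <= f n h.
  have q0 : 0 < n %/ h by rewrite divn_gt0.
  have em : eqpart m i <= 2 * (n %/ h).
    have : m %/ h <= n %/ h by apply: leq_div2r; rewrite leq_pred.
    by rewrite /eqpart; case: (_ < _); lia.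
  have lt : eqpart m i < n.
    have : n %/ h <= n %/ 64 by apply: leq_div2l.
    lia.
  rewrite -IH //.
  have p8 : 0 < 8 ^ h by rewrite expn_gt0.
  rewrite -(leq_pmul2r p8) -mulnA -expnMn.
  apply: leq_trans (_ : _ <= max_ind_copies H (eqpart m i) * h ^ h) _.
    by rewrite leq_mul2l leq_exp2r ?h64 ?orbT.
  apply: leq_trans (leq_mul (max_ind_copies_bin _ _) (leqnn _)) _.
  apply: leq_trans (bin_le_div _ _) _.
  apply: leq_trans (_ : _ <= (8 * (n %/ h)) ^ h) _.
    by rewrite leq_exp2r //; lia.
  rewrite expnMn mulnC leq_mul2r; apply/orP; right.
  rewrite -[X in _ ^ X]card_ord -prod_nat_const /f; apply: leq_prod => j _.
  by rewrite /eqpart leq_addr.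
have sumg : 2 * n * (\sum_(i < h) g (eqpart m i) h) <= f n h.
  have p8 : 0 < 8 ^ h by rewrite expn_gt0.
  rewrite -(leq_pmul2r p8) -mulnA big_distrl /=.
  apply: (@leq_trans (2 * n * (h * f n h))).
    rewrite leq_mul2l; apply/orP; right; rewrite -[X in X * _]card_ord -sum_nat_const.
    exact: leq_sum.
  rewrite mulnA mulnC leq_mul2l; apply/orP; right.
  have -> : 8 ^ h = 2 ^ h * 2 ^ h * 2 ^ h by rewrite -!expnMn.
  have two : 2 <= 2 ^ h by rewrite -[X in X <= _]expn1 leq_exp2l.
  exact: (leq_mul (leq_mul two n2) (ltnW (ltn_expl h (isT : 1 < 2)))).
have avoid : #|[set X in copies H G | v \notin X]| <=
    f m h + \sum_(i < h) g (eqpart m i) h.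
  have -> : [set X in copies H G | v \notin X] =
      [set X in copies H G | X \subset [set~ v]].
    apply/setP => X; rewrite in_set [RHS]in_set; congr (_ && _).
    by rewrite -disjoints_subset disjoint_sym disjoints1.
  apply: leq_trans (copies_in_max _ _ _) _.
  rewrite cardsC1 -/n -/m IH ?En // gE; last by lia.
  by case: ifP.
have tot : #|copies H G| = #|[set X in copies H G | v \in X]| +
    #|[set X in copies H G | v \notin X]|.
  rewrite -(cardsID [set X : {set T} | v \in X] (copies H G)).
  congr (_ + _); apply: eq_card => X; rewrite [RHS]in_set.
    by rewrite in_setI [X in _ && X]in_set.
  by rewrite in_setD [X in ~~ X]in_set andbC.
have fm : n * f m h + f n h <= n * f n h.
  have FS := f_succ m h0; rewrite -En in FS.
  have Kn : (m %/ h).+1 <= n by rewrite En ltnS leq_div.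
  have ff : f m h <= f n h by rewrite f_mono // leq_pred.
  move: FS Kn ff; set K := m %/ h; set u := f m h; set w := f n h; clear.
  nia.
move: many tot avoid sumg fm; set a := #|copies H G|.
set b := #|_|; set c := #|_|; set S := \sum_(_ < _) _.
set u := f m h; set w := f n h => wa Ea cle Sle fle.
have : n * w <= n * (b + (u + S)).
  by rewrite leq_mul2l (leq_trans wa) ?orbT // Ea leq_add2l.
by move: Sle fle; rewrite !mulnDr; clear; lia.
Qed.

Lemma prod_equitable (h n : nat) (a : 'I_h -> nat) : 0 < h ->
  equitable_partition n a -> \prod_i a i = f n h.
Proof.
move=> h0 ea; rewrite /f -(big_map a xpredT id) -(big_map (@eqpart n h) xpredT id).
by apply: perm_big; have := equitable_partition_perm h0 ea; rewrite !codomE !enumT.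
Qed.

Lemma sum_equitable (h n : nat) (a : 'I_h -> nat) (F : nat -> nat) : 0 < h ->
  equitable_partition n a -> \sum_i F (a i) = \sum_(i < h) F (eqpart n i).
Proof.
move=> h0 ea; rewrite -(big_map a xpredT F) -(big_map (@eqpart n h) xpredT F).
by apply: perm_big; have := equitable_partition_perm h0 ea; rewrite !codomE !enumT.
Qed.

Lemma equitable_lt (h n : nat) (a : 'I_h -> nat) (i : 'I_h) : 1 < h -> 1 < n ->
  equitable_partition n a -> a i < n.
Proof.
move=> h1 n1 [an ea].
have [j ji] : exists j, j != i.
  have : 0 < #|predC1 i| by rewrite cardC1 card_ord; lia.
  by case/card_gt0P => j; rewrite inE => ji; exists j.
have := ea i j; move: an; rewrite (bigD1 i) //= (bigD1 j) //=; lia.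
Qed.

Lemma adj_filled_same (h : nat) (H : graph 'I_h) (a : 'I_h -> nat)
    (Gs : forall i, graph 'I_(a i)) (i : 'I_h) (x y : 'I_(a i)) :
  adj (filled_blowup H Gs) (Tagged (fun i => 'I_(a i)) x)
    (Tagged (fun i => 'I_(a i)) y) = adj (Gs i) x y.
Proof.
have E : tagged_as (Tagged (fun i => 'I_(a i)) x) (Tagged (fun i => 'I_(a i)) y) = y.
  exact: tagged_asE.
by rewrite adj_filled_blowup eqxx E.
Qed.

Lemma exact_filled (h : nat) (H : graph 'I_h) (a : 'I_h -> nat)
    (Gs : forall i, graph 'I_(a i)) : exact_roles H (filled_blowup H Gs) tag.
Proof. by move=> x y xy; rewrite adj_filled_blowup (negbTE xy). Qed.

Lemma ind_copies_filled (h : nat) (H : graph 'I_h) (a : 'I_h -> nat)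
    (Gs : forall i, graph 'I_(a i)) : 1 < h -> prime_graph H ->
  ind_copies H (filled_blowup H Gs) = \prod_i a i + \sum_i ind_copies H (Gs i).
Proof.
move=> h1 pH.
have im i : [set x : blowup_vertex a | tag x == i] =
    (fun x : 'I_(a i) => Tagged (fun i => 'I_(a i)) x) @: setT.
  apply/setP => x; rewrite inE; apply/eqP/imsetP => [<-|[y _ ->]] //.
  by exists (tagged x); rewrite // taggedK.
have Ti i : injective (fun x : 'I_(a i) => Tagged (fun i => 'I_(a i)) x).
  by move=> x y /eqP; rewrite eq_Tagged => /eqP.
rewrite ind_copiesE (card_copies_exact _ pH (@exact_filled _ H _ Gs)) ?card_ord //.
congr (_ + _).
  by apply: eq_bigr => i _; rewrite im (card_imset _ (@Ti i)) cardsT card_ord.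
apply: eq_bigr => i _; rewrite im ind_copiesE; symmetry.
by apply: card_copies_sub => [|x y]; [apply: Ti | apply: adj_filled_same].
Qed.

Lemma filled_plus_part_edges (h : nat) (H : graph 'I_h) (a : 'I_h -> nat)
    (Gs : forall i, graph 'I_(a i)) :
  blowup_plus_part_edges H (filled_blowup H Gs).
Proof.
have two (F : graph (blowup_vertex a)) e :
    e \in edges F -> exists x y, e = [set x; y].
  move=> eF; have /forall_inP/(_ _ eF)/cards2P[x [y [_ ->]]] := valP F.
  by exists x, y.
split.
  apply/subsetP => e eB; have [x [y Ee]] := two _ _ eB.
  have : adj (blowup H a) x y by rewrite /adj /= -Ee.
  rewrite adj_blowup => A; have xy : tag x != tag y.
    by apply: contraTneq A => ->; rewrite adj_irr.
  have : adj (filled_blowup H Gs) x y by rewrite exact_filled.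
  by rewrite /adj /= -Ee.
move=> e; rewrite inE => /andP[eB eF]; have [x [y Ee]] := two _ _ eF.
have [xy|xy] := eqVneq (tag x) (tag y).
  apply/existsP; exists (tag x); apply/subsetP => z.
  by rewrite Ee !inE => /orP[] /eqP ->; rewrite ?xy.
have : adj (filled_blowup H Gs) x y by rewrite /adj /= -Ee.
rewrite exact_filled // -adj_blowup => A.
by move: eB; rewrite Ee => /negP; case.
Qed.

Lemma iso_filled (h : nat) (H : graph 'I_h) (T : finType) (G : graph T)
    (w : T -> 'I_h) : exact_roles H G w ->
  iso G (filled_blowup H (fun i => sub_graph G [set x | w x == i])).
Proof.
move=> ex; apply: iso_sym.
pose a i := #|[set x | w x == i]|.
pose u (x : blowup_vertex a) : T := enum_val (tagged x).
have wu x : w (u x) = tag x.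
  by have := enum_valP (tagged x); rewrite inE => /eqP.
exists u; split; last first.
  move=> x y; have [xy|xy] := eqVneq (tag x) (tag y); last first.
    by rewrite ex ?wu // exact_filled.
  case: x y xy => i x [j y] /= ij; subst j.
  by rewrite (adj_filled_same _ _ x y) adj_sub_graph.
have S z : exists x, u x = z.
  have zw : z \in [set x | w x == w z] by rewrite inE.
  exists (Tagged (fun i => 'I_(a i)) (enum_rank_in zw z)).
  by rewrite /u /= enum_rankK_in.
have uI : injective u.
  move=> x y E; have xy : tag x = tag y by rewrite -!wu E.
  case: x y xy E => i x [j y] /= ij; subst j => /enum_val_inj E.
  by congr existT.
have [v vK] := choice S.
exists v => // x; by apply: uI; rewrite vK.
Qed.

Lemma graph_on_ord (T : finType) (G : graph T) (n : nat) : #|T| = n ->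
  exists G' : graph 'I_n, iso G' G.
Proof.
move=> <-; exists (mk_graph [rel x y | adj G (enum_val x) (enum_val y)]).
exists enum_val; split; first by exists enum_rank; [exact: enum_valK | exact: enum_rankK].
move=> x y; rewrite adj_mk_graph /=; last by move=> u v; apply: adj_sym.
by case: eqVneq => // ->; rewrite adj_irr.
Qed.

Lemma card_blowup_vertex (h : nat) (a : 'I_h -> nat) :
  #|blowup_vertex a| = \sum_i a i.
Proof.
rewrite card_tagged sumnE big_map big_enum /=.
by apply: eq_bigr => i _; rewrite card_ord.
Qed.

Lemma nested_exists (h : nat) (H : graph 'I_h) (n : nat) : 1 < h ->
  exists G : graph 'I_n, nested_blowup H G.
Proof.
move=> h1; have [m] := ubnP n; elim: m n => // m IH n nm.
have [nh|hn] := ltnP n h.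
  by exists (mk_graph [rel x y | false]); apply: nested_small.
have ea := @eqpart_equitable n h (ltnW h1).
have F (i : 'I_h) : exists G : graph 'I_(eqpart n i), nested_blowup H G.
  by apply: IH; have := equitable_lt i h1 (leq_trans h1 hn) ea; lia.
pose Gs i := sval (cid (F i)).
have [|G GI] := @graph_on_ord _ (filled_blowup H Gs) n.
  by rewrite card_blowup_vertex; case: ea.
exists G; apply: (nested_step hn ea _ GI) => i.
exact: (svalP (cid (F i))).
Qed.

Lemma nested_copies (h : nat) (H : graph 'I_h) (n : nat) (G : graph 'I_n) :
  1 < h -> prime_graph H -> nested_blowup H G -> ind_copies H G = g n h.
Proof.
move=> h1 pH; elim=> {n G} [n G nh|n G a Gs hn ea _ IH GI].
  rewrite gE // nh; apply/eqP; rewrite -leqn0.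
  by apply: leq_trans (ind_copies_bin H G) _; rewrite bin_small.
rewrite (ind_copies_iso H GI) ind_copies_filled // gE // ltnNge hn /=.
rewrite (prod_equitable (ltnW h1) ea); congr (_ + _).
by rewrite -(sum_equitable (fun m => g m h) (ltnW h1) ea); apply: eq_bigr.
Qed.

(** * The induction on the number of vertices *)

Section Main.
Variables (R : realType) (h A : nat) (H : graph 'I_h).
Hypotheses (sa : strongly_asymmetric R H) (Ah : A <= h) (A2050 : 2050 <= A).
Hypothesis cst : exists M k t ee,
  [/\ [/\ 0 < M, 8 * M <= A & 8 * M * h <= A * t],
    [/\ 32 ^ h <= M ^ k, 10 ^ 5 * (2 * t) <= h, 10 * k <= h & k + 50 * t < ee],
    h <= 2 ^ 17 * ee & 30 * (2050 * ee) <= h].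
Variable Q : {set 'I_h}.
Hypothesis dQ : distinguishing H Q.

Let h2050 : 2050 <= h. Proof. exact: leq_trans Ah. Qed.
Let h1 : 1 < h. Proof. exact: leq_trans h2050. Qed.
Let h0 : 0 < h. Proof. exact: ltnW h1. Qed.
Let pH : prime_graph H.
Proof. by apply: (asym_prime sa); apply: leq_trans h2050. Qed.

(** The values for smaller orders enter through [copies_through]. *)
Lemma equitable_structure (n : nat) (G : graph 'I_n) : h <= n ->
  n ^ (A * (#|Q| + 9)) <= 2 ^ h ->
  (forall m, m < n -> max_ind_copies H m = g m h) ->
  f n h <= ind_copies H G ->
  exists w : 'I_n -> 'I_h, exact_roles H G w /\
    equitable_partition n (fun i => #|[set x | w x == i]|).
Proof.
move=> hn sl IH; rewrite ind_copiesE => many.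
have [M [k [t [ee [[M0 MA MAt] [Mk ht hk kte] he eh]]]]] := cst.
have x0 : 'I_n by exists 0; apply: leq_trans hn.
have [emb embP] := copies_choice H G x0.
have cn : #|'I_n| = n by rewrite card_ord.
have hn' : h <= #|'I_n| by rewrite cn.
have n2 : #|'I_n| <= 2 ^ h.
  rewrite cn; apply: leq_trans sl; rewrite -[X in X <= _]expn1 leq_pexp2l //.
    exact: leq_trans hn.
  by rewrite muln_gt0 addn_gt0 orbT andbT; apply: leq_trans A2050.
have h64 : 64 <= h by apply: leq_trans h2050.
have h200 : 200 <= h by apply: leq_trans h2050.
have sl' : #|'I_n| ^ (A * (#|Q| + 9)) <= 2 ^ h by rewrite cn.
have many' : f #|'I_n| h <= #|copies H G| by rewrite cn.
have IH' m : m < #|'I_n| -> max_ind_copies H m = g m h by rewrite cn; apply: IH.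
have thr := copies_through h64 hn' n2 IH' many'.
have [w [wE wq]] := blowup_structure sa embP h200 hn' A2050 Ah M0 MA MAt Mk ht hk kte
  he eh dQ sl' many' thr.
exists w; split=> //; split=> //.
rewrite -[RHS]cn -cardsT -(sum_fibers w).
by apply: eq_bigr => i _; apply: eq_card => x; rewrite !inE.
Qed.

Lemma exact_copies (n : nat) (G : graph 'I_n) (w : 'I_n -> 'I_h) :
  exact_roles H G w -> equitable_partition n (fun i => #|[set x | w x == i]|) ->
  ind_copies H G =
    f n h + \sum_i ind_copies H (sub_graph G [set x | w x == i]).
Proof.
move=> wE ea; rewrite ind_copiesE (card_copies_exact _ pH wE) ?card_ord //.
rewrite (prod_equitable h0 ea); congr (_ + _).
by apply: eq_bigr => i _; rewrite card_copies_in.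
Qed.

(** Value and extremal graphs go through one induction: smaller values yield the blowup structure,
    and equality in the sum over the parts makes every part extremal, hence nested. *)
Lemma max_ind_copiesE (n : nat) : n ^ (A * (#|Q| + 9)) <= 2 ^ h ->
  max_ind_copies H n = g n h /\
  forall G : graph 'I_n, ind_copies H G = max_ind_copies H n -> nested_blowup H G.
Proof.
have [m] := ubnP n; elim: m n => // m IHm n nm sl.
have mono p : p < n -> p ^ (A * (#|Q| + 9)) <= 2 ^ h.
  by move=> /ltnW pn; apply: leq_trans sl; apply: expn_le_mono.
have IH p : p < n -> max_ind_copies H p = g p h /\
    forall G : graph 'I_p, ind_copies H G = max_ind_copies H p -> nested_blowup H G.
  by move=> pn; apply: IHm; [lia | apply: mono].
have IH1 p : p < n -> max_ind_copies H p = g p h by move/IH => [].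
have [nh|hn] := ltnP n h.
  split=> [|G _]; last exact: nested_small.
  rewrite gE // nh; apply/eqP; rewrite -leqn0.
  by apply: leq_trans (max_ind_copies_bin n H) _; rewrite bin_small.
have n1 : 1 < n := leq_trans h1 hn.
have fg : f n h <= g n h by rewrite gE // ltnNge hn leq_addr.
have gS (w : 'I_n -> 'I_h) :
    equitable_partition n (fun i => #|[set x | w x == i]|) ->
    g n h = f n h + \sum_i g #|[set x | w x == i]| h.
  move=> ea; rewrite gE // ltnNge hn /=; congr (_ + _).
  by rewrite -(sum_equitable (fun m => g m h) h0 ea).
have le (w : 'I_n -> 'I_h) (G : graph 'I_n) i :
    equitable_partition n (fun i => #|[set x | w x == i]|) ->
    ind_copies H (sub_graph G [set x | w x == i]) <= g #|[set x | w x == i]| h.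
  move=> ea; rewrite -IH1; first exact: ind_copies_max.
  exact: (equitable_lt i h1 n1 ea).
have maxg : max_ind_copies H n = g n h.
  apply/eqP; rewrite eqn_leq; apply/andP; split; last first.
    have [G /(nested_copies h1 pH) <-] := nested_exists H n h1.
    exact: ind_copies_max.
  apply/bigmax_leqP => G _; have [small|many] := ltnP (ind_copies H G) (f n h).
    exact: leq_trans (ltnW small) fg.
  have [w [wE ea]] := equitable_structure hn sl IH1 many.
  rewrite (exact_copies wE ea) (gS w ea) leq_add2l; apply: leq_sum => i _.
  exact: le.
split=> // G; rewrite maxg => GE.
have [w [wE ea]] := equitable_structure hn sl IH1 (leq_trans fg (eq_leq (esym GE))).
apply: (nested_step hn ea _ (iso_filled wE)) => i.
have lt : #|[set x | w x == i]| < n := equitable_lt i h1 n1 ea.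
have [E] := IH _ lt; apply; rewrite E.
move: GE; rewrite (exact_copies wE ea) (gS w ea) => /addnI GE.
apply/eqP; rewrite eqn_leq le //= leqNgt; apply/negP => strict.
have : \sum_j ind_copies H (sub_graph G [set x | w x == j]) <
    \sum_j g #|[set x | w x == j]| h.
  rewrite (bigD1 i) //= [X in _ < X](bigD1 i) //= -addSn leq_add //.
  by apply: leq_sum => j _; apply: le.
by rewrite GE ltnn.
Qed.
End Main.

Import Order.TTheory GRing.Theory Num.Theory.
Local Open Scope ring_scope.

Theorem theorem2 (R : realType) :
  exists h0 : nat, forall h : nat, (h0 < h)%N ->
  forall H : graph 'I_h, strongly_asymmetric R H ->
  forall n : nat, (0 < n)%N -> n%:R <= 2 `^ Num.sqrt h%:R :> R ->
  (max_ind_copies H n = g n h /\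
   forall G : graph 'I_n,
     ind_copies H G = max_ind_copies H n <-> nested_blowup H G) /\
  ((h <= n)%N ->
   forall G : graph 'I_n, (f n h <= ind_copies H G)%N ->
   exists a : 'I_h -> nat, equitable_partition n a /\
   exists B : graph (blowup_vertex a),
     blowup_plus_part_edges H B /\ iso G B).
Proof.
have [A [A2050 cst]] := constants; have [h1 sl] := slack R A.
exists (maxn A h1) => h; rewrite gtn_max => /andP[/ltnW Ah /ltnW hh1] H sa n _ nR.
have [Q [dQ Qh]] := sa_distinguishing sa.
have slQ := sl h n _ hh1 nR Qh.
have [maxg nest] := max_ind_copiesE sa Ah A2050 (cst h Ah) dQ slQ.
have hgt : (1 < h)%N by rewrite (leq_trans _ Ah) // (leq_trans _ A2050).
have pH : prime_graph H.
  by apply: (asym_prime sa); rewrite (leq_trans _ Ah) // (leq_trans _ A2050).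
split; first split=> // G.
  split; first exact: nest.
  by rewrite maxg; apply: nested_copies.
move=> hn G many.
have IH m : (m < n)%N -> max_ind_copies H m = g m h.
  move=> mn; have slm : (m ^ (A * (#|Q| + 9)) <= 2 ^ h)%N.
    by apply: leq_trans slQ; apply/expn_le_mono/ltnW.
  by have [] := max_ind_copiesE sa Ah A2050 (cst h Ah) dQ slm.
have [w [wE ea]] := equitable_structure sa Ah A2050 (cst h Ah) dQ hn slQ IH many.
exists (fun i => #|[set x | w x == i]|); split=> //.
exists (filled_blowup H (fun i => sub_graph G [set x | w x == i])).
by split; [apply: filled_plus_part_edges | apply: iso_filled].
Qed.
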